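(* Let $X$ be a complex Banach space that is finite-dimensional or a Hilbert space, $E=\ell^2(\mathbb Z,X)$, and let $A\in L(E)$ be band-dominated. Let $(A^{(n)})_{n\in\mathbb N}$ be a sequence of banded operators in $L(E)$ such that $\delta_n:=\|A-A^{(n)}\|\to0$ as $n\to\infty$, let $w_n\in\mathbb N$ be the band-width of $A^{(n)}$, and let $A_n:=\mathcal I_{w_n}A^{(n)}\mathcal I_{w_n}^{-1}$ (so that $A_n$ is $A^{(n)}$ written in tridiagonal form). Then, for $\varepsilon\ge0$ and $n\in\mathbb N$, $$\mathrm{Spec}_\varepsilon A\ \subset\ \Gamma^n_{\varepsilon+\delta_n+\varepsilon''_n(A_n)}(A_n)\ \subset\ \mathrm{Spec}_{\varepsilon+2\delta_n+\varepsilon''_n(A_n)}A,$$ so that $d_H\big(\Gamma^n_{\varepsilon+\delta_n+\varepsilon''_n(A_n)}(A_n),\mathrm{Spec}_\varepsilon A\big)\to0$ as $n\to\infty$; in particular $d_H\big(\Gamma^n_{\delta_n+\varepsilon''_n(A_n)}(A_n),\mathrm{Spec}\,A\big)\to0$.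
   Context: $E=\ell^2(\mathbb Z,X)$ has norm $(\sum_j\|x_j\|_X^2)^{1/2}$. An operator $B\in L(E)$ with matrix $[b_{i,j}]_{i,j\in\mathbb Z}$, $b_{i,j}\in L(X)$, is banded with band-width $w$ if $b_{i,j}=0$ for $|i-j|>w$; it is band-dominated if it is a limit in operator norm of banded operators. $B$ is tridiagonal if it has band-width one. For $b\in\mathbb N$, $\mathcal I_b:E\to\ell^2(\mathbb Z,X^b)$ maps $x=(x_i)$ to $\xi=(\xi_i)$, $\xi_i=(x_{bi+1},\dots,x_{b(i+1)})\in X^b$, where $X^b$ has norm $(\sum_{j=1}^b\|\xi_j\|_X^2)^{1/2}$; it is an isometric isomorphism, and $\mathcal I_bB\mathcal I_b^{-1}$ is tridiagonal (with entries in $L(X^b)$) if $B$ has band-width $\le b$. For a tridiagonal operator $B$ on $\ell^2(\mathbb Z,Z)$ ($Z$ a Banach space) with matrix $[b_{i,j}]$: $r(B):=\sup_i\|b_{i+1,i}\|+\sup_i\|b_{i-1,i}\|$, $\varepsilon''_n(B):=2r(B)\sin\frac{\pi}{2(n+1)}$; $$\mu_n(B):=\inf_{k\in\mathbb Z}\min\big(\nu(B|_{E_{n,k}}),\nu(B^*|_{E_{n,k}})\big),\qquad \Gamma^n_\varepsilon(B):=\{\lambda\in\mathbb C:\mu_n(B-\lambda I)\le\varepsilon\}\ (\varepsilon\ge0),$$ where $\nu(C):=\inf_{\|x\|=1}\|Cx\|$, $B^*$ is the Banach space adjoint acting on $\ell^2(\mathbb Z,Z^* )$ (matrix $[b_{j,i}^*]$),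 and $E_{n,k}$ is the subspace of sequences (in $\ell^2(\mathbb Z,Z)$, respectively $\ell^2(\mathbb Z,Z^* )$) supported in $\{k+1,\dots,k+n\}$. $\mathrm{Spec}_\varepsilon B:=\{\lambda:1/\|(B-\lambda I)^{-1}\|\le\varepsilon\}$ for $\varepsilon>0$ (with $\|C^{-1}\|:=\infty$ if $C$ is not invertible, $1/\infty:=0$), $\mathrm{Spec}_0B:=\mathrm{Spec}\,B$. $d_H(S,T):=\max(\sup_{s\in S}\mathrm{dist}(s,T),\sup_{t\in T}\mathrm{dist}(t,S))$ for bounded non-empty $S,T\subset\mathbb C$. *)

(* Defs.v *)
From HB Require Import structures.
From mathcomp Require Import all_boot all_order all_algebra sesquilinear.
From mathcomp Require Import complex ring lra zify.
From mathcomp Require Import all_classical all_reals all_analysis.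

Set Implicit Arguments.
Unset Strict Implicit.
Unset Printing Implicit Defensive.

Import Order.TTheory GRing.Theory Num.Theory.
Import numFieldNormedType.Exports.

Local Open Scope classical_set_scope.
Local Open Scope ring_scope.
Local Open Scope complex_scope.

Section RealNorm.
Variable R : realType.

(* The norm of a normedModType R[i] takes its values in R[i]. *)
Definition rnorm (V : normedModType R[i]) (x : V) : R := complex.Re `|x|.

Variable V : normedModType R[i].
Implicit Types (x y : V) (a : R[i]).

Lemma rnormE x : `|x| = (rnorm x)%:C.
Proof. by rewrite /rnorm RRe_real. Qed.

Lemma rnorm_ge0 x : 0 <= rnorm x.
Proof. by rewrite -lecR -rnormE; exact: normr_ge0. Qed.

Lemma ler_rnormD x y : rnorm (x + y) <= rnorm x + rnorm y.
Proof. by rewrite -lecR -rnormE rmorphD /= -!rnormE ler_normD. Qed.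

Lemma rnormZ a x : rnorm (a *: x) = complex.Re `|a| * rnorm x.
Proof.
apply: complexI.
by rewrite -rnormE normrZ rnormE rmorphM.
Qed.

Lemma rnorm0 : rnorm (0 : V) = 0.
Proof. by rewrite /rnorm normr0. Qed.

Lemma rnorm_eq0 x : rnorm x = 0 -> x = 0.
Proof. by move=> x0; apply/eqP; rewrite -normr_eq0 rnormE x0. Qed.

Lemma rnormN x : rnorm (- x) = rnorm x.
Proof. by rewrite /rnorm normrN. Qed.

Lemma Re_norm_ge0 a : 0 <= complex.Re `|a|.
Proof. by rewrite -lecR RRe_real//; exact: normr_ge0. Qed.

End RealNorm.

Section NormFromReal.
Variables (R : realType) (V : lmodType R[i]) (N : V -> R).
Hypothesis N_ge0 : forall x, 0 <= N x.
Hypothesis ND : forall x y, N (x + y) <= N x + N y.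
Hypothesis NZ_le : forall a x, N (a *: x) <= complex.Re `|a| * N x.

Lemma real_normD x y : (N (x + y))%:C <= (N x)%:C + (N y)%:C.
Proof. by rewrite -rmorphD lecR. Qed.

Lemma real_normZ a x : (N (a *: x))%:C = `|a| * (N x)%:C.
Proof.
suff -> : N (a *: x) = complex.Re `|a| * N x by rewrite rmorphM.
apply/le_anti; rewrite NZ_le andTb.
have [->|a0] := eqVneq a 0.
  by rewrite normr0 mul0r N_ge0.
rewrite -[in leLHS](scalerK a0 x).
have na0 : 0 < complex.Re `|a| by rewrite -ltcR RRe_real// normr_gt0.
rewrite -ler_pdivlMl//; apply: le_trans (NZ_le _ _) _.
rewrite (_ : complex.Re `|a^-1| = (complex.Re `|a|)^-1)//.
apply: complexI; rewrite fmorphV /= -[LHS]/`|a^-1| normfV; congr (_^-1).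
Qed.

End NormFromReal.

Section L2space.
Variables (R : realType) (I : choiceType) (V : normedModType R[i]).
Implicit Types (x y : I -> V) (a : R[i]).

Definition sqsum x : \bar R := \esum_(i in setT) (rnorm (x i) ^+ 2)%:E.

Lemma sqsum_ge0 x : (0 <= sqsum x)%E.
Proof. by apply: esum_ge0 => i _; rewrite lee_fin sqr_ge0. Qed.

Lemma esum_scale_le (c : R) (f : I -> \bar R) : 0 <= c ->
  (forall i, 0 <= f i)%E ->
  (\esum_(i in setT) (c%:E * f i) <= c%:E * \esum_(i in setT) f i)%E.
Proof.
move=> c0 f0; apply: ge_ereal_sup => _ [A AT <-].
rewrite -ge0_mule_fsumr//; apply: lee_wpmul2l; first by rewrite lee_fin.
by apply: ereal_sup_ubound; exists A.
Qed.

Lemma sqsum_le_scale (J : normedModType R[i]) (M : R) x (y : I -> J) : 0 <= M ->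
  (forall i, rnorm (x i) <= M * rnorm (y i)) ->
  (sqsum x <= (M ^+ 2)%:E * \esum_(i in setT) (rnorm (y i) ^+ 2)%:E)%E.
Proof.
move=> M0 xy; apply: le_trans (esum_scale_le _ _); last 2 first.
- exact: sqr_ge0.
- by move=> i; rewrite lee_fin sqr_ge0.
apply: le_esum => i _; rewrite -EFinM lee_fin -exprMn.
by rewrite ler_pXn2r// nnegrE ?mulr_ge0 ?rnorm_ge0.
Qed.

Lemma sqsumD_le (t : R) x y : 0 < t ->
  (sqsum (x + y)%R <= (1 + t)%:E * sqsum x + (1 + t^-1)%:E * sqsum y)%E.
Proof.
move=> t0; have t1 : 0 < t^-1 by rewrite invr_gt0.
apply: (@le_trans _ _ (\esum_(i in setT) ((1 + t)%:E * (rnorm (x i) ^+ 2)%:E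
                     + (1 + t^-1)%:E * (rnorm (y i) ^+ 2)%:E))%E); last first.
  rewrite esumD; last 2 first.
  - by move=> i _; rewrite -EFinM lee_fin mulr_ge0 ?sqr_ge0// addr_ge0// ltW.
  - by move=> i _; rewrite -EFinM lee_fin mulr_ge0 ?sqr_ge0// addr_ge0// ltW.
  apply: leeD; apply: esum_scale_le => [|i].
  - by rewrite addr_ge0// ltW.
  - by rewrite lee_fin sqr_ge0.
  - by rewrite addr_ge0// ltW.
  - by rewrite lee_fin sqr_ge0.
apply: le_esum => i _; rewrite -!EFinM -EFinD lee_fin.
set u := rnorm (x i); set v := rnorm (y i).
have u0 : 0 <= u := rnorm_ge0 _; have v0 : 0 <= v := rnorm_ge0 _.
apply: (@le_trans _ _ ((u + v) ^+ 2)).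
  by rewrite ler_pXn2r// ?nnegrE ?addr_ge0 ?rnorm_ge0 ?ler_rnormD.
have : 0 <= t^-1 * (t * u - v) ^+ 2 by rewrite mulr_ge0 ?sqr_ge0// ltW.
rewrite sqrrB mulrDr mulrBr exprMn expr2 !mulrA mulVf ?gt_eqF// mul1r.
rewrite mulrnAr !mulrA mulVf ?gt_eqF// mul1r => h.
rewrite sqrrD !mulrDl !mul1r -subr_ge0; apply: le_trans h _.
by rewrite le_eqVlt; apply/orP; left; apply/eqP; rewrite !mulr2n; ring.
Qed.

Lemma sqsumZ_le a x : (sqsum (a *: x) <= (complex.Re `|a| ^+ 2)%:E * sqsum x)%E.
Proof.
apply: sqsum_le_scale => [|i]; first exact: Re_norm_ge0.
by rewrite /= rnormZ.
Qed.

Lemma sqsum0 : sqsum (0 : I -> V) = 0%E.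
Proof. by apply: esum1 => i _; rewrite /= rnorm0 expr0n. Qed.

Definition sqsummable : {pred I -> V} := [pred x | (sqsum x < +oo)%E].

Lemma sqsummable_submod : submod_closed sqsummable.
Proof.
split => [|a x y]; first by rewrite inE /= sqsum0 ltry.
rewrite !inE /= => xoo yoo.
apply: le_lt_trans (sqsumD_le _ _ ltr01) _.
rewrite lte_add_pinfty// lte_mul_pinfty ?lee_fin ?addr_ge0 ?invr_ge0 ?sqsum_ge0//.
apply: le_lt_trans (sqsumZ_le _ _) _.
by rewrite lte_mul_pinfty ?sqr_ge0// lee_fin sqr_ge0.
Qed.

HB.instance Definition _ :=
  GRing.isSubmodClosed.Build _ _ sqsummable sqsummable_submod.

Record l2 := MkL2 { l2_fun :> I -> V ; l2_subproof : l2_fun \in sqsummable }.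

HB.instance Definition _ := [isSub for l2_fun].
HB.instance Definition _ := [Choice of l2 by <:].
HB.instance Definition _ := [SubChoice_isSubLmodule of l2 by <:].

Definition l2_norm (x : l2) : R := Num.sqrt (fine (sqsum x)).

Lemma sqsum_fin (x : l2) : sqsum x \is a fin_num.
Proof. by rewrite ge0_fin_numE ?sqsum_ge0//; have := l2_subproof x. Qed.

Lemma sqsumE (x : l2) : sqsum x = (l2_norm x ^+ 2)%:E.
Proof. by rewrite sqr_sqrtr ?fineK ?sqsum_fin// fine_ge0// sqsum_ge0. Qed.

Lemma l2_norm_ge0 (x : l2) : 0 <= l2_norm x.
Proof. exact: sqrtr_ge0. Qed.

Lemma l2_norm_le (x : l2) M : 0 <= M -> (sqsum x <= (M ^+ 2)%:E)%E -> l2_norm x <= M.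
Proof.
by move=> M0; rewrite sqsumE lee_fin ler_pXn2r// nnegrE ?l2_norm_ge0.
Qed.

Lemma rnorm_coord_le (x : l2) i : rnorm (x i) <= l2_norm x.
Proof.
rewrite -(@ler_pXn2r _ 2) ?nnegrE ?rnorm_ge0 ?l2_norm_ge0// -lee_fin -sqsumE.
apply: esum_ge; exists [set i]; first by split.
by rewrite fsbig_set1.
Qed.

Lemma l2_norm_eq0 (x : l2) : l2_norm x = 0 -> x = 0.
Proof.
move=> x0; apply/val_inj/funext => i /=; apply: rnorm_eq0.
by apply/le_anti; rewrite rnorm_ge0 andbT -x0 rnorm_coord_le.
Qed.

Lemma ler_l2_normD (x y : l2) : l2_norm (x + y) <= l2_norm x + l2_norm y.
Proof.
have [->|x0] := eqVneq x 0; first by rewrite add0r lerDr l2_norm_ge0.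
have [->|y0] := eqVneq y 0; first by rewrite addr0 lerDl l2_norm_ge0.
have npos z : z != 0 -> 0 < l2_norm z.
  by move=> z0; rewrite lt_def l2_norm_ge0 andbT; apply: contra z0 => /eqP/l2_norm_eq0/eqP.
have /npos := x0; have /npos := y0.
set p := l2_norm x; set q := l2_norm y => q0 p0.
apply: l2_norm_le; first by rewrite addr_ge0 ?ltW.
apply: le_trans (@sqsumD_le (q / p) _ _ _) _; first by rewrite divr_gt0.
rewrite !sqsumE -/p -/q -!EFinM -EFinD lee_fin le_eqVlt; apply/orP; left; apply/eqP.
by field; rewrite !gt_eqF.
Qed.

Lemma l2_normZ_le a (x : l2) : l2_norm (a *: x) <= complex.Re `|a| * l2_norm x.
Proof.
apply: l2_norm_le; first by rewrite mulr_ge0 ?Re_norm_ge0 ?l2_norm_ge0.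
by apply: le_trans (sqsumZ_le _ _) _; rewrite sqsumE -EFinM exprMn.
Qed.

Lemma l2_norm_eq0C (x : l2) : (l2_norm x)%:C = 0 -> x = 0.
Proof. by move=> /complexI/l2_norm_eq0. Qed.

HB.instance Definition _ := Lmodule_isNormed.Build R[i] l2
  (real_normD ler_l2_normD) (real_normZ l2_norm_ge0 l2_normZ_le) l2_norm_eq0C.

Lemma rnorm_l2E (x : l2) : rnorm x = l2_norm x.
Proof. by []. Qed.

End L2space.

Section BoundedOperators.
Variables (R : realType) (V W : normedModType R[i]).

Definition bounded_linear : {pred V -> W} :=
  [pred f : V -> W | `[< linear f /\
    exists M : R, forall x, rnorm (f x) <= M * rnorm x >]].

Lemma bounded_linear_submod : submod_closed bounded_linear.
Proof.
split=> [|a f g].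
  apply/asboolP; split=> [b x y /=|]; first by rewrite scaler0 addr0.
  by exists 0 => x /=; rewrite rnorm0 mul0r.
move=> /asboolP[lf [M fM]] /asboolP[lg [L gL]]; apply/asboolP; split=> [b x y|].
  rewrite -[LHS]/(a *: f (b *: x + y) + g (b *: x + y)).
  rewrite -[RHS]/(b *: (a *: f x + g x) + (a *: f y + g y)).
  rewrite lf lg !scalerDr !scalerA [b * a]mulrC -!addrA; congr (_ + _).
  by rewrite addrCA.
exists (complex.Re `|a| * M + L) => x.
rewrite -[X in rnorm X]/(a *: f x + g x); apply: le_trans (ler_rnormD _ _) _.
by rewrite mulrDl lerD// rnormZ -mulrA ler_wpM2l ?Re_norm_ge0.
Qed.

HB.instance Definition _ :=
  GRing.isSubmodClosed.Build _ _ bounded_linear bounded_linear_submod.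

Record bop := MkBop {
  bop_fun :> V -> W ; bop_subproof : bop_fun \in bounded_linear }.

HB.instance Definition _ := [isSub for bop_fun].
HB.instance Definition _ := [Choice of bop by <:].
HB.instance Definition _ := [SubChoice_isSubLmodule of bop by <:].

Lemma bop_linear (T : bop) : linear T.
Proof. by case/asboolP: (bop_subproof T). Qed.

HB.instance Definition _ (T : bop) :=
  GRing.isLinear.Build R[i] V W *:%R (bop_fun T) (bop_linear T).

Definition opnorm (T : bop) : R :=
  sup [set rnorm (T x) | x in [set x | rnorm x <= 1]].

Lemma opnorm_has_sup (T : bop) :
  has_sup [set rnorm (T x) | x in [set x | rnorm x <= 1]].
Proof.
split; first by exists (rnorm (T 0)), 0 => //=; rewrite rnorm0 ler01.
have /asboolP[_ [M TM]] := bop_subproof T.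
exists `|M| => _ [x /= x1 <-]; apply: le_trans (TM x) _.
by apply: le_trans (ler_norm _) _; rewrite normrM ler_piMr// ger0_norm ?rnorm_ge0.
Qed.

Lemma opnorm_ge0 (T : bop) : 0 <= opnorm T.
Proof.
apply: le_trans (rnorm_ge0 (T 0)) _; apply: sup_upper_bound.
  exact: opnorm_has_sup.
by exists 0 => //=; rewrite rnorm0 ler01.
Qed.

Lemma rnorm_bop_le (T : bop) x : rnorm (T x) <= opnorm T * rnorm x.
Proof.
have [->|x0] := eqVneq x 0; first by rewrite linear0 !rnorm0 mulr0.
have nx0 : 0 < rnorm x.
  by rewrite lt_def rnorm_ge0 andbT; apply: contra x0 => /eqP/rnorm_eq0/eqP.
have nxC : complex.Re `|(rnorm x)^-1%:C| = (rnorm x)^-1.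
  by rewrite ger0_norm// lecR invr_ge0 ltW.
rewrite -ler_pdivrMr// mulrC -nxC -rnormZ -linearZ; apply: sup_upper_bound.
  exact: opnorm_has_sup.
by exists ((rnorm x)^-1%:C *: x) => //=; rewrite rnormZ nxC mulVf// gt_eqF.
Qed.

Lemma opnorm_le (T : bop) M : 0 <= M ->
  (forall x, rnorm (T x) <= M * rnorm x) -> opnorm T <= M.
Proof.
move=> M0 TM; apply: ge_sup; first exact: (opnorm_has_sup T).1.
by move=> _ [x /= x1 <-]; apply: le_trans (TM x) _; rewrite ler_piMr.
Qed.

Lemma opnorm_eq0 (T : bop) : (opnorm T)%:C = 0 -> T = 0.
Proof.
move=> /complexI T0; apply/val_inj/funext => x /=; apply: rnorm_eq0.
by apply/le_anti; rewrite rnorm_ge0 andbT -[leRHS](mul0r (rnorm x)) -T0 rnorm_bop_le.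
Qed.

Lemma ler_opnormD (S T : bop) : opnorm (S + T) <= opnorm S + opnorm T.
Proof.
apply: opnorm_le => [|x]; first by rewrite addr_ge0 ?opnorm_ge0.
by apply: le_trans (ler_rnormD _ _) _; rewrite mulrDl lerD ?rnorm_bop_le.
Qed.

Lemma opnormZ_le a (T : bop) : opnorm (a *: T) <= complex.Re `|a| * opnorm T.
Proof.
apply: opnorm_le => [|x]; first by rewrite mulr_ge0 ?Re_norm_ge0 ?opnorm_ge0.
by rewrite [leLHS]rnormZ -mulrA ler_wpM2l ?Re_norm_ge0 ?rnorm_bop_le.
Qed.

HB.instance Definition _ := Lmodule_isNormed.Build R[i] bop
  (real_normD ler_opnormD) (real_normZ opnorm_ge0 opnormZ_le) opnorm_eq0.

Lemma rnorm_bopE (T : bop) : rnorm T = opnorm T.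
Proof. by []. Qed.

Section Build.
Variables (f : V -> W) (lf : linear f) (M : R).
Hypothesis fM : forall x, rnorm (f x) <= M * rnorm x.

Lemma mk_bop_subproof : f \in bounded_linear.
Proof. by apply/asboolP; split=> //; exists M. Qed.

Definition mk_bop : bop := MkBop mk_bop_subproof.

End Build.

End BoundedOperators.

Section OperatorAlgebra.
Variable R : realType.
Implicit Types U V W : normedModType R[i].

Lemma bid_bound V (x : V) : rnorm (idfun x) <= 1 * rnorm x.
Proof. by rewrite mul1r. Qed.

Lemma bid_linear V : linear (@idfun V).
Proof. by []. Qed.

Definition bid V : bop V V := mk_bop (@bid_linear V) (@bid_bound V).

Section Comp.
Variables (U V W : normedModType R[i]) (S : bop V W) (T : bop U V).

Lemma bcomp_linear : linear (S \o T).
Proof. by move=> a x y /=; rewrite !linearP. Qed.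

Lemma bcomp_bound x : rnorm ((S \o T) x) <= opnorm S * opnorm T * rnorm x.
Proof.
apply: le_trans (rnorm_bop_le _ _) _.
by rewrite -mulrA ler_wpM2l ?opnorm_ge0// rnorm_bop_le.
Qed.

Definition bcomp : bop U W := mk_bop bcomp_linear bcomp_bound.

End Comp.

Definition is_inverse V W (T : bop V W) (S : bop W V) : Prop :=
  bcomp S T = bid V /\ bcomp T S = bid W.

Definition invertible V W (T : bop V W) : Prop := exists S, is_inverse T S.

(* The norm of the inverse, +oo if there is none. *)
Definition inv_norm V W (T : bop V W) : \bar R :=
  if pselect (invertible T) is left TI then (rnorm (projT1 (cid TI)))%:E
  else +oo%E.

Definition spectrum V (B : bop V V) : set R[i] :=
  [set lambda | ~ invertible (B - lambda *: bid V)].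

(* The inverse of extended reals satisfies +oo^-1 = 0 and 0^-1 = +oo. *)
Definition pseudospectrum V (eps : R) (B : bop V V) : set R[i] :=
  if eps == 0 then spectrum B
  else [set lambda | ((inv_norm (B - lambda *: bid V)%R)^-1 <= eps%:E)%E].

Definition dual V : normedModType R[i] := bop V R[i]^o.

Section Adjoint.
Variables (V W : normedModType R[i]) (T : bop V W).

Definition badjoint_fun (phi : dual W) : dual V := bcomp phi T.

Lemma badjoint_linear : linear badjoint_fun.
Proof. by move=> a phi psi; apply/val_inj/funext. Qed.

Lemma badjoint_bound phi : rnorm (badjoint_fun phi) <= opnorm T * rnorm phi.
Proof.
apply: opnorm_le => [|x]; first by rewrite mulr_ge0 ?opnorm_ge0.
by rewrite [opnorm T * _]mulrC bcomp_bound.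
Qed.

Definition badjoint : bop (dual W) (dual V) :=
  mk_bop badjoint_linear badjoint_bound.

Lemma opnorm_badjoint_le : opnorm badjoint <= opnorm T.
Proof. by apply: opnorm_le; [exact: opnorm_ge0|exact: badjoint_bound]. Qed.

End Adjoint.

Definition lower_norm_on V W (T : bop V W) (S : set V) : \bar R :=
  ereal_inf [set (rnorm (T x))%:E | x in [set x | S x /\ rnorm x = 1]].

End OperatorAlgebra.

Section PartialReindex.
Variables (R : realType) (V : normedModType R[i]).

Lemma sqsum_pairs (I J : choiceType) (x : I -> l2 J V) :
  sqsum x = sqsum (fun k : I * J => x k.1 k.2).
Proof.
rewrite /sqsum; under eq_esum do rewrite rnorm_l2E -sqsumE.
rewrite esum_esum; last by move=> i j _ _; rewrite lee_fin sqr_ge0.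
by congr esum; apply/seteqP; split.
Qed.

Lemma sqsum_reindex (I J : choiceType) (e : J -> option I) (x : I -> V) :
  (forall j j' i, e j = Some i -> e j' = Some i -> j = j') ->
  (sqsum (fun j => oapp x 0%R (e j)) <= sqsum x)%E.
Proof.
move=> einj; pose a (o : option I) : \bar R := (rnorm (oapp x 0 o) ^+ 2)%:E.
have a0 o : (0 <= a o)%E by rewrite lee_fin sqr_ge0.
pose D := [set j | isSome (e j)].
have -> : sqsum (fun j => oapp x 0 (e j)) = \esum_(j in D) a (e j).
  rewrite [RHS]esum_mkcond; apply: eq_esum => j _.
  case: ifPn => //; rewrite /D notin_setE /=; case: (e j) => //= _.
  by rewrite rnorm0 expr0n.
have -> : sqsum x = \esum_(o in Some @` [set: I]) a o.
  by rewrite esum_image//; move=> i i' _ _ [].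
rewrite -(esum_image D e a); last first.
  move=> j j'; rewrite /D !inE /=; case ej : (e j) => [i|]// _ _ ej'.
  exact: einj ej (esym ej').
apply: ereal_sup_le => _ [A [finA AD] <-]; exists A => //; split => // o /AD [j].
by rewrite /D /=; case: (e j) => // i _ <-; exists i.
Qed.

Lemma sqsum_reindex_mem (I J : choiceType) (e : J -> option I) (x : l2 I V) :
  (forall j j' i, e j = Some i -> e j' = Some i -> j = j') ->
  (fun j => oapp x 0 (e j)) \in @sqsummable R J V.
Proof.
move=> einj; apply: le_lt_trans (sqsum_reindex _ einj) _.
exact: (l2_subproof x).
Qed.

End PartialReindex.

Section Matrix.
Variables (R : realType) (I : choiceType).
Implicit Type V : normedModType R[i].

Section Single.
Variables (V : normedModType R[i]) (i : I).

Definition l2_single_fun (v : V) : I -> V := fun j => if j == i then v else 0.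

Lemma sqsum_single_le v : (sqsum (l2_single_fun v) <= (rnorm v ^+ 2)%:E)%E.
Proof.
pose e j := if j == i then Some tt else None.
have -> : l2_single_fun v = fun j => oapp (fun=> v) 0 (e j).
  by apply/funext => j; rewrite /l2_single_fun /e; case: ifP.
apply: le_trans (@sqsum_reindex R V _ _ e (fun=> v) _) _ => [j j' ?|].
  by rewrite /e; do 2![case: eqP => // ->].
rewrite /sqsum (_ : [set: unit] = [set tt]) ?esum_set1 ?lee_fin ?sqr_ge0//.
by apply/seteqP; split=> [[]|].
Qed.

Lemma l2_single_subproof v : l2_single_fun v \in @sqsummable R I V.
Proof. exact: le_lt_trans (sqsum_single_le v) (ltry _). Qed.

Definition l2_single v : l2 I V := MkL2 (l2_single_subproof v).

Lemma l2_single_linear : linear l2_single.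
Proof.
move=> a u v; apply/val_inj/funext => j /=.
rewrite -[RHS]/(a *: l2_single_fun u j + l2_single_fun v j) /l2_single_fun.
by case: ifP => // _; rewrite scaler0 addr0.
Qed.

Lemma rnorm_l2_single_le v : rnorm (l2_single v) <= rnorm v.
Proof. by apply: l2_norm_le; [exact: rnorm_ge0|exact: sqsum_single_le]. Qed.

End Single.

Section Entry.
Variables (V W : normedModType R[i]) (B : bop (l2 I V) (l2 I W)) (i j : I).

Definition entry_fun (v : V) : W := B (l2_single j v) i.

Lemma entry_linear : linear entry_fun.
Proof. by move=> a u v; rewrite /entry_fun l2_single_linear linearP. Qed.

Lemma entry_bound v : rnorm (entry_fun v) <= opnorm B * rnorm v.
Proof.
apply: le_trans (rnorm_coord_le (B (l2_single j v)) i) _.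
rewrite -rnorm_l2E; apply: le_trans (rnorm_bop_le _ _) _.
by rewrite ler_wpM2l ?opnorm_ge0// rnorm_l2_single_le.
Qed.

Definition entry : bop V W := mk_bop entry_linear entry_bound.

Lemma opnorm_entry_le : opnorm entry <= opnorm B.
Proof. by apply: opnorm_le; [exact: opnorm_ge0|exact: entry_bound]. Qed.

End Entry.

End Matrix.

Section Banded.
Variables (R : realType) (V : normedModType R[i]).
Local Notation L := (bop (l2 int V) (l2 int V)).
Implicit Type B : L.

Definition has_bandwidth (w : nat) B : Prop :=
  forall i j : int, w%:Z < `|i - j| -> entry B i j = 0.

Definition banded B : Prop := exists w, has_bandwidth w B.

Definition band_dominated B : Prop :=
  exists Bn : nat -> L, (forall n, banded (Bn n)) /\ Bn n @[n --> \oo] --> B.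

End Banded.

Section TridiagonalAdjoint.
Variables (R : realType) (V : normedModType R[i]).
Variable B : bop (l2 int V) (l2 int V).

Section Diagonal.
Variable s : int.

Definition adjoint_diag_raw (f : l2 int (dual V)) : int -> dual V :=
  fun i => badjoint (entry B (i + s) i) (f (i + s)).

Lemma sqsum_adjoint_diag f :
  (sqsum (adjoint_diag_raw f) <= ((opnorm B * rnorm f) ^+ 2)%:E)%E.
Proof.
pose e (i : int) : option int := Some (i + s).
apply: le_trans (@sqsum_le_scale _ _ _ _ (opnorm B) _
  (fun i => oapp f 0 (e i)) _ _) _ => [|i|].
- exact: opnorm_ge0.
- apply: le_trans (rnorm_bop_le _ _) _; rewrite ler_wpM2r ?rnorm_ge0//.
  exact: le_trans (opnorm_badjoint_le _) (opnorm_entry_le _ _ _).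
- rewrite exprMn [in leRHS]EFinM rnorm_l2E -sqsumE; apply: lee_wpmul2l.
    by rewrite lee_fin sqr_ge0.
  by apply: (@sqsum_reindex R (dual V) _ _ e f) => i j _ <- [] /addIr.
Qed.

Lemma adjoint_diag_subproof f :
  adjoint_diag_raw f \in @sqsummable R int (dual V).
Proof. exact: le_lt_trans (sqsum_adjoint_diag f) (ltry _). Qed.

Definition adjoint_diag_fun f := MkL2 (adjoint_diag_subproof f).

Lemma adjoint_diag_linear : linear adjoint_diag_fun.
Proof.
move=> a f g; apply/val_inj/funext => i.
exact: (linearP (badjoint (entry B (i + s) i))).
Qed.

Lemma adjoint_diag_bound f :
  rnorm (adjoint_diag_fun f) <= opnorm B * rnorm f.
Proof.
apply: l2_norm_le; last exact: sqsum_adjoint_diag.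
by rewrite mulr_ge0 ?opnorm_ge0 ?rnorm_ge0.
Qed.

Definition adjoint_diag : bop (l2 int (dual V)) (l2 int (dual V)) :=
  mk_bop adjoint_diag_linear adjoint_diag_bound.

End Diagonal.

(* For tridiagonal B, this is the Banach space adjoint of B under the usual
   identification of the dual of l2 int V with l2 int (dual V); its matrix is
   the content of the next lemma. *)
Definition tridiag_adjoint : bop (l2 int (dual V)) (l2 int (dual V)) :=
  adjoint_diag (-1) + adjoint_diag 0 + adjoint_diag 1.

Lemma entry_tridiag_adjoint (i j : int) : has_bandwidth 1 B ->
  entry tridiag_adjoint i j = badjoint (entry B j i).
Proof.
move=> B1; apply/val_inj/funext => phi.
have tE s : adjoint_diag s (l2_single j phi) i =
    if j == i + s then badjoint (entry B j i) phi else 0.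
  rewrite -[LHS]/(badjoint (entry B (i + s) i) (l2_single_fun j phi (i + s))).
  rewrite /l2_single_fun eq_sym.
  by case: eqP => [<-//|_]; rewrite linear0.
rewrite -[LHS]/(adjoint_diag (-1) (l2_single j phi) i +
  adjoint_diag 0 (l2_single j phi) i + adjoint_diag 1 (l2_single j phi) i) !tE.
rewrite -[RHS]/(badjoint (entry B j i) phi).
have [ij|ij] := leP `|j - i| 1; last first.
  rewrite B1//; have -> : badjoint (0 : bop V V) phi = 0.
    by apply/val_inj/funext => x; rewrite /= linear0.
  by rewrite !if_same !addr0.
move: ij; rewrite ler_norml => /andP[ij1 ij2].
have : [|| j == i - 1, j == i + 0 | j == i + 1] by lia.
case/or3P => /eqP ->.
- by rewrite eqxx ifF ?ifF ?addr0//; lia.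
- by rewrite eqxx ifF ?[in X in _ + X]ifF ?add0r ?addr0//; lia.
- by rewrite eqxx ifF ?ifF ?add0r//; lia.
Qed.

End TridiagonalAdjoint.

Section Blocking.
Variables (R : realType) (V : normedModType R[i]) (b : nat).

Lemma block_inj (k k' : int * 'I_b) :
  k.1 * b%:Z + 1 + (k.2 : nat)%:Z = k'.1 * b%:Z + 1 + (k'.2 : nat)%:Z ->
  k = k'.
Proof.
case: k k' => [i j] [i' j'] /= h.
have b0 : (0 < b)%N := leq_ltn_trans (leq0n j) (ltn_ord j).
have {}h : i * b%:Z + (j : nat)%:Z = i' * b%:Z + (j' : nat)%:Z by lia.
have jb := ltn_ord j; have jb' := ltn_ord j'.
have ii' : i = i'.
  have := congr1 (fun m => (m %/ b%:Z)%Z) h.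
  by rewrite /= !divzMDl ?eqz_nat -?lt0n// !divz_nat !divn_small// !addr0.
by rewrite ii' in h *; congr (_, _); apply/val_inj => /=; lia.
Qed.

Section Block.
Variable x : l2 int V.

Lemma block_in_subproof (i : int) :
  (fun j : 'I_b => x (i * b%:Z + 1 + (j : nat)%:Z)) \in @sqsummable R 'I_b V.
Proof.
apply: (@sqsum_reindex_mem R V _ _ (fun j : 'I_b =>
  Some (i * b%:Z + 1 + (j : nat)%:Z)) x) => j j' _ <- [] h.
by have [] := @block_inj (i, j') (i, j) h.
Qed.

Definition block_raw (i : int) : l2 'I_b V := MkL2 (block_in_subproof i).

Lemma sqsum_block : (sqsum block_raw <= (rnorm x ^+ 2)%:E)%E.
Proof.
rewrite sqsum_pairs rnorm_l2E -sqsumE.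
apply: (@sqsum_reindex R V _ _ (fun k : int * 'I_b =>
  Some (k.1 * b%:Z + 1 + (k.2 : nat)%:Z)) x) => k k' _ <- [] h.
exact/esym/block_inj.
Qed.

Lemma block_subproof : block_raw \in @sqsummable R int (l2 'I_b V).
Proof. exact: le_lt_trans sqsum_block (ltry _). Qed.

Definition block_fun : l2 int (l2 'I_b V) := MkL2 block_subproof.

End Block.

Lemma block_linear : linear block_fun.
Proof.
by move=> a x y; apply/val_inj/funext => i; apply/val_inj/funext => j.
Qed.

Lemma block_bound x : rnorm (block_fun x) <= 1 * rnorm x.
Proof.
by rewrite mul1r; apply: l2_norm_le; [exact: rnorm_ge0|exact: sqsum_block].
Qed.

(* X^b with its Euclidean norm is l2 'I_b X, the coordinates being numbered
   from 0 instead of 1. *)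
Definition block : bop (l2 int V) (l2 int (l2 'I_b V)) :=
  mk_bop block_linear block_bound.

(* The formula also makes sense for b = 0, where it gives the zero map; for
   0 < b it is the inverse of block (lemma block_unblock). *)
Section Unblock.
Variable xi : l2 int (l2 'I_b V).

Definition unblock_raw (m : int) : V :=
  if insub `|((m - 1) %% b)%Z|%N is Some j then xi ((m - 1) %/ b)%Z j else 0.

Lemma sqsum_unblock : (sqsum unblock_raw <= (rnorm xi ^+ 2)%:E)%E.
Proof.
rewrite rnorm_l2E -sqsumE sqsum_pairs.
pose e (m : int) : option (int * 'I_b) :=
  omap (pair ((m - 1) %/ b)%Z) (insub `|((m - 1) %% b)%Z|%N).
have -> : unblock_raw = fun m => oapp (fun k => xi k.1 k.2) 0 (e m).
  by apply/funext => m; rewrite /unblock_raw /e; case: insub.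
apply: sqsum_reindex => m m' k; rewrite /e.
case: insubP => //= j _ jm [<-]; case: insubP => //= j' _ jm' [qq jj].
have b0 : (0 < b)%N := leq_ltn_trans (leq0n j) (ltn_ord j).
have bZ : b%:Z != 0 by rewrite eqz_nat -lt0n.
have h : ((m - 1) %% b)%Z = ((m' - 1) %% b)%Z.
  by rewrite -[LHS]gez0_abs ?modz_ge0// -[RHS]gez0_abs ?modz_ge0// -jm -jm' jj.
by apply: (addIr (-1)); rewrite (divz_eq (m - 1) b) h -qq -divz_eq.
Qed.

Lemma unblock_subproof : unblock_raw \in @sqsummable R int V.
Proof. exact: le_lt_trans sqsum_unblock (ltry _). Qed.

Definition unblock_fun : l2 int V := MkL2 unblock_subproof.

End Unblock.

Lemma unblock_linear : linear unblock_fun.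
Proof.
move=> a x y; apply/val_inj/funext => m.
rewrite -[RHS]/(a *: unblock_raw x m + unblock_raw y m) /= /unblock_raw.
by case: insub => //; rewrite scaler0 addr0.
Qed.

Lemma unblock_bound xi : rnorm (unblock_fun xi) <= 1 * rnorm xi.
Proof.
by rewrite mul1r; apply: l2_norm_le; [exact: rnorm_ge0|exact: sqsum_unblock].
Qed.

Definition unblock : bop (l2 int (l2 'I_b V)) (l2 int V) :=
  mk_bop unblock_linear unblock_bound.

Lemma block_unblock : (0 < b)%N -> is_inverse block unblock.
Proof.
move=> b0; have bZ : b%:Z != 0 by rewrite eqz_nat -lt0n.
split; apply/val_inj/funext => x; apply/val_inj/funext => m /=.
  rewrite /unblock_raw /=.
  case: insubP => [j _ jm|]; last first.
    by rewrite -ltz_nat gez0_abs ?modz_ge0// ltz_pmod.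
  by rewrite /= jm gez0_abs ?modz_ge0// addrAC -divz_eq subrK.
apply/val_inj/funext => j /=; rewrite /unblock_raw.
have -> : m * b%:Z + 1 + (j : nat)%:Z - 1 = m * b%:Z + (j : nat)%:Z by lia.
rewrite modzMDl divzMDl// modz_nat divz_nat modn_small// divn_small// addr0.
by rewrite absz_nat valK.
Qed.

Definition tridiagonal_form (B : bop (l2 int V) (l2 int V)) :
  bop (l2 int (l2 'I_b V)) (l2 int (l2 'I_b V)) :=
  bcomp block (bcomp B unblock).

End Blocking.

Section Gamma.
Variables (R : realType) (V : normedModType R[i]).
Implicit Types (B : bop (l2 int V) (l2 int V)) (n : nat) (k : int).

Definition window (U : normedModType R[i]) n k : set (l2 int U) :=
  [set x | forall i : int, ~~ (k + 1 <= i <= k + n%:Z) -> x i = 0].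

Definition mu n B : \bar R :=
  ereal_inf [set Order.min (lower_norm_on B (@window V n k))
                   (lower_norm_on (tridiag_adjoint B) (@window (dual V) n k))
            | k in [set: int]].

Definition Gamma n (eps : R) B : set R[i] :=
  [set lambda | (mu n (B - lambda *: bid _)%R <= eps%:E)%E].

Definition offdiag_norm B : R :=
  sup [set rnorm (entry B (i + 1) i) | i in [set: int]] +
  sup [set rnorm (entry B (i - 1) i) | i in [set: int]].

Definition eps_pp n B : R := 2 * offdiag_norm B * sin (pi / (2 * n.+1%:R)).

End Gamma.

Section Hausdorff.
Variable R : realType.
Implicit Types S T : set R[i].

Definition dist_to (z : R[i]) T : \bar R :=
  ereal_inf [set (complex.Re `|z - t|)%:E | t in T].

(* Valued in [0, +oo]; the outer maximum with 0 matters only if S and T are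
   both empty, since ereal_sup set0 = -oo. *)
Definition hausdorff_dist S T : \bar R :=
  Order.max 0%E (Order.max (ereal_sup [set dist_to s T | s in S])
                           (ereal_sup [set dist_to t S | t in T])).

End Hausdorff.

Section SpaceHypotheses.
Variables (R : realType) (X : normedModType R[i]).

Definition finite_dimensional : Prop :=
  exists n (f : {linear X -> 'rV[R[i]]_n}), bijective f.

Definition hilbert_norm : Prop :=
  exists ip : {dot X for @conjc R}, forall x : X, `|x| ^+ 2 = ip x x.

End SpaceHypotheses.

(* Main.v *)
Require Import Defs.
From HB Require Import structures.
From mathcomp Require Import all_boot all_order all_algebra.
From mathcomp Require Import complex ring lra zify.
From mathcomp Require Import all_classical all_reals all_analysis.

Set Implicit Arguments.
Unset Strict Implicit.
Unset Printing Implicit Defensive.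

Import Order.TTheory GRing.Theory Num.Theory.
Import numFieldNormedType.Exports.

Local Open Scope classical_set_scope.
Local Open Scope ring_scope.

(* Localization. For a tridiagonal [B] and a vector [x], cut [x] by the translates of the
   weight m |-> sin(m pi/(n+1)) supported in the windows of length [n]. Averaging over the
   translates, a lower bound [c] for [B] on all windows gives the lower bound
   [c - eps_pp n B] on the whole space. The dual of l2(Z, V) is l2(Z, V^* ), so the same
   holds for the adjoint. By the Hahn-Banach theorem, a bounded operator on a Banach space
   such that it and its adjoint are bounded below by [c > 0] is invertible with an inverse of
   norm at most 1/c. Hence the complements of pseudospectra and of the sets [Gamma] are both
   described by a pair of lower bounds, and these change by at most [rnorm (A - A')] when [A]
   is replaced by [A'], which gives the two inclusions. Since [eps_pp] and [delta] tend to 0,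
   the Hausdorff convergence follows from the inclusions and from the compactness of the
   pseudospectra, which decrease to [pseudospectrum eps A]. *)

(** * Finitely supported vectors and the dual of l2 *)

Section FinitelySupported.
Variables (R : realType) (I : choiceType) (V : normedModType R[i]).
Implicit Types (x y : I -> V) (s : seq I).

Lemma l2_ext (x y : l2 I V) : (forall i, x i = y i) -> x = y.
Proof. by move=> xy; apply/val_inj/funext. Qed.

Lemma sum_le_sqsum x s : uniq s ->
  ((\sum_(i <- s) rnorm (x i) ^+ 2)%:E <= sqsum x)%E.
Proof.
move=> us; apply: esum_ge; exists [set` s]; first by split.
by rewrite -fsbig_seq// sumEFin.
Qed.

Lemma sqsum_le_fin x M :
  (forall s, uniq s -> \sum_(i <- s) rnorm (x i) ^+ 2 <= M) ->
  (sqsum x <= M%:E)%E.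
Proof.
move=> xM; apply: ge_ereal_sup => _ [A [finA _] <-].
by rewrite fsbig_finite//= sumEFin lee_fin xM// finmap.fset_uniq.
Qed.

(** A sum of single vectors, so that linearity evaluates operators on it; for duplicate-free [s] it
    truncates [y] to [s], and [y] need not be square-summable. *)
Definition l2_fin s y : l2 I V := \sum_(i <- s) l2_single i (y i).

Lemma l2_coord_linear i : linear (fun x : l2 I V => x i).
Proof. by []. Qed.

Lemma l2_coord_bound i (x : l2 I V) : rnorm (x i) <= 1 * rnorm x.
Proof. by rewrite mul1r rnorm_l2E; exact: rnorm_coord_le. Qed.

Definition l2_coord i : bop (l2 I V) V := mk_bop (@l2_coord_linear i) (@l2_coord_bound i).

Lemma l2_finE s y j : uniq s -> l2_fin s y j = if j \in s then y j else 0.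
Proof.
rewrite -[LHS]/(l2_coord j (l2_fin s y)) /l2_fin linear_sum /=.
elim: s => [|i s IH] /=; first by rewrite big_nil.
case/andP => ins us; rewrite big_cons IH// inE [l2_single_fun _ _ _]/l2_single_fun.
case: eqVneq => [->|_] /=; last by rewrite add0r.
by rewrite (negPf ins) addr0.
Qed.

Lemma rnorm_sqr_l2 (x : l2 I V) : (rnorm x ^+ 2)%:E = sqsum x.
Proof. by rewrite sqsumE. Qed.

Lemma rnorm_l2_fin s y : uniq s ->
  rnorm (l2_fin s y) ^+ 2 = \sum_(i <- s) rnorm (y i) ^+ 2.
Proof.
move=> us; apply: EFin_inj; rewrite rnorm_sqr_l2 /sqsum.
under eq_esum do rewrite l2_finE//.
rewrite -sumEFin fsbig_seq// -esum_fset//; last by move=> i _; rewrite lee_fin sqr_ge0.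
rewrite [RHS]esum_mkcond; apply: eq_esum => i _.
rewrite mem_setE.
by case: ifP => //; rewrite rnorm0 expr0n.
Qed.

(** [sqsum] is a supremum of finite sums, so some finite set captures all but [e ^+ 2] of it. *)
Lemma l2_fin_dense (x : l2 I V) e : 0 < e ->
  exists2 s, uniq s & rnorm (x - l2_fin s x) <= e.
Proof.
move=> e0.
have : (sqsum x - (e ^+ 2)%:E < sqsum x)%E.
  by rewrite sqsumE -EFinB lte_fin gtrBl exprn_gt0.
case/ereal_sup_gt => _ [A [finA _] <-].
rewrite fsbig_finite//=; set s := finmap.enum_fset (fset_set A) => h.
have us : uniq s by exact: finmap.fset_uniq.
exists s => //; rewrite -(@ler_pXn2r _ 2) ?nnegrE ?rnorm_ge0 ?(ltW e0)//.
rewrite -lee_fin rnorm_sqr_l2.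
(* Pythagoras: the truncation and the remainder have disjoint supports. *)
have xs : sqsum x = ((\sum_(i <- s) rnorm (x i) ^+ 2)%:E + sqsum (x - l2_fin s x)%R)%E.
  rewrite -rnorm_l2_fin// rnorm_sqr_l2 /sqsum -esumD => [|i _|i _]; last 2 first.
  - by rewrite lee_fin sqr_ge0.
  - by rewrite lee_fin sqr_ge0.
  apply: eq_esum => i _.
  rewrite -[l2_fun (x - l2_fin s x) i]/(x i - l2_fin s x i) l2_finE//.
  by case: ifP; rewrite -EFinD ?subrr ?subr0 rnorm0 expr0n/= ?addr0 ?add0r.
move: h; rewrite sumEFin {1}xs.
case: (sqsum _) => [r||] //=; last by rewrite leNye.
by rewrite -!EFinD lte_fin lee_fin; lra.
Qed.

End FinitelySupported.

Section FinitelySupportedOperators.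
Variables (R : realType) (I : choiceType) (V W : normedModType R[i]).

Lemma rnorm_small0 (v : W) : (forall e : R, 0 < e -> rnorm v <= e) -> v = 0.
Proof.
move=> ve; apply: rnorm_eq0; apply/le_anti; rewrite rnorm_ge0 andbT.
by apply/ler_addgt0Pl => e e0; rewrite addr0; exact: ve.
Qed.

Lemma bop_l2_fin_le (T : bop (l2 I V) W) (x : l2 I V) M :
  (forall s, uniq s -> rnorm (T (l2_fin s x)) <= M) -> rnorm (T x) <= M.
Proof.
move=> TM; apply/ler_addgt0Pl => e e0.
have e'0 : 0 < e / (opnorm T + 1) by rewrite divr_gt0// ltr_wpDl ?opnorm_ge0.
have [s us xs] := l2_fin_dense x e'0.
rewrite -(subrK (l2_fin s x) x) linearD; apply: le_trans (ler_rnormD _ _) _.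
rewrite lerD ?TM//; apply: le_trans (rnorm_bop_le _ _) _.
rewrite -[leRHS](@divfK _ (opnorm T + 1) _ e) ?gt_eqF ?ltr_wpDl ?opnorm_ge0//.
by rewrite mulrC ler_pM ?rnorm_ge0 ?opnorm_ge0// lerDl.
Qed.

Lemma bop_l2_fin (T : bop (l2 I V) W) s y :
  T (l2_fin s y) = \sum_(i <- s) T (l2_single i (y i)).
Proof. by rewrite linear_sum. Qed.

Lemma bop_single_eq0 (T : bop (l2 I V) W) (x : l2 I V) :
  (forall i, T (l2_single i (x i)) = 0) -> T x = 0.
Proof.
move=> T0; apply: rnorm_eq0; apply/le_anti; rewrite rnorm_ge0 andbT.
apply: bop_l2_fin_le => s us; rewrite bop_l2_fin big1 ?rnorm0//.
Qed.

End FinitelySupportedOperators.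

(** * Isometric embedding of the dual of l2 into l2 of the dual *)

Section DualCoordinates.
Local Open Scope complex_scope.
Variables (R : realType) (I : choiceType) (V : normedModType R[i]).

Lemma l2_single_bound (i : I) (v : V) : rnorm (l2_single i v) <= 1 * rnorm v.
Proof. by rewrite mul1r rnorm_l2_single_le. Qed.

Definition l2_inj (i : I) : bop V (l2 I V) :=
  mk_bop (@l2_single_linear R I V i) (@l2_single_bound i).

(** Multiplying an almost norming vector by a unimodular scalar makes the value of [f] real and
    non-negative. *)
Lemma dual_near_norming (f : dual V) (e : R) : 0 < e ->
  exists2 v : V, rnorm v <= 1 & exists2 c : R, f v = c%:C & rnorm f - e <= c.
Proof.
move=> e0; have : opnorm f - e < opnorm f by rewrite gtrBl.
case/sup_gt; first exact: (opnorm_has_sup f).1.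
move=> _ [v /= v1 <-] fv.
pose z : R[i] := f v.
have [z0|z0] := eqVneq z 0.
  exists v => //; exists 0; first exact: z0.
  by move: fv; rewrite [f v]z0 rnorm0 => /ltW.
exists ((`|z| / z) *: v).
  by rewrite rnormZ normf_div normr_id divff ?normr_eq0//= mul1r.
exists (complex.Re `|z|); [|exact: ltW fv].
by rewrite linearZ /= -[f v]/z -[_ *: _]/(`|z| / z * z) divfK.
Qed.

(** Cauchy-Schwarz, by summing a weighted inequality between arithmetic and geometric means. The
    weights require positive bounds, so [p] and [q] are enlarged by a small [u]. *)
Lemma sum_mul_le (s : seq I) (a b : I -> R) (p q : R) : 0 <= p -> 0 <= q ->
  \sum_(i <- s) a i ^+ 2 <= p ^+ 2 -> \sum_(i <- s) b i ^+ 2 <= q ^+ 2 ->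
  \sum_(i <- s) a i * b i <= p * q.
Proof.
move=> p0 q0 ap bq; apply/ler_addgt0Pl => e e0.
pose t := e / (p + q + 1) .
have key r r' : 0 < r -> 0 < r' -> \sum_(i <- s) a i ^+ 2 <= r ^+ 2 ->
    \sum_(i <- s) b i ^+ 2 <= r' ^+ 2 -> \sum_(i <- s) a i * b i <= r * r'.
  move=> r0 r'0 ar br'.
  have : \sum_(i <- s) a i * b i <=
     \sum_(i <- s) (r' / r / 2 * a i ^+ 2 + r / r' / 2 * b i ^+ 2).
    apply: ler_sum => i _; rewrite -subr_ge0.
    have -> : r' / r / 2 * a i ^+ 2 + r / r' / 2 * b i ^+ 2 - a i * b i =
      (r' * a i - r * b i) ^+ 2 / (2 * r * r') by field; rewrite !gt_eqF.
    by rewrite divr_ge0 ?sqr_ge0// !mulr_ge0// ltW.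
  move/le_trans; apply; rewrite big_split/= -!mulr_sumr.
  apply: (@le_trans _ _ (r' / r / 2 * r ^+ 2 + r / r' / 2 * r' ^+ 2)).
    by apply: lerD; apply: ler_wpM2l => //; rewrite !divr_ge0// ltW.
  by rewrite le_eqVlt; apply/orP; left; apply/eqP; field; rewrite !gt_eqF.
have d0 : 0 < p + q + 1 by rewrite ltr_wpDl// addr_ge0.
(* Since [u <= 1], the error [(p + u) * (q + u) - p * q] is at most [u * (p + q + 1)], hence at most
   [e]. *)
pose u := Num.min 1 t.
have t0 : 0 < t by rewrite divr_gt0.
have u0 : 0 < u by rewrite lt_min ltr01.
have u1 : u <= 1 by rewrite ge_min lexx.
have ut : u * (p + q + 1) <= e by rewrite -ler_pdivlMr// ge_min lexx orbT.
apply: (le_trans (key (p + u) (q + u) _ _ _ _)); rewrite ?ltr_wpDl//.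
- by apply: (le_trans ap); rewrite ler_pXn2r ?nnegrE ?lerDl ?addr_ge0// ltW.
- by apply: (le_trans bq); rewrite ler_pXn2r ?nnegrE ?lerDl ?addr_ge0// ltW.
- by nra.
Qed.

Lemma rnormC (c : R) : @rnorm R R[i]^o c%:C = `|c|.
Proof.
by rewrite /rnorm -[`|_|]/(`|c%:C : R[i]|) normc_def /= expr0n addr0 sqrtr_sqr.
Qed.

Variable phi : dual (l2 I V).

Definition dual_coord (i : I) : dual V := bcomp phi (l2_inj i).

(** Test [phi] on the finite vector whose coordinates are almost norming vectors scaled by the norms
    of the coordinates of [phi]: its norm is at most the square root of [Q], while the value of
    [phi] is almost [Q]. *)
Lemma sum_dual_coord_le s : uniq s ->
  \sum_(i <- s) rnorm (dual_coord i) ^+ 2 <= rnorm phi ^+ 2.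
Proof.
move=> us; set Q := \sum_(i <- s) _.
have Q0 : 0 <= Q by apply: sumr_ge0 => i _; exact: sqr_ge0.
pose P := \sum_(i <- s) rnorm (dual_coord i).
have P0 : 0 <= P by apply: sumr_ge0 => i _; exact: rnorm_ge0.
have sqP : Num.sqrt Q ^+ 2 = Q by rewrite sqr_sqrtr.
suff h : Q <= rnorm phi * Num.sqrt Q.
  have [->|q0] := eqVneq Q 0; first exact: sqr_ge0.
  have {}q0 : 0 < Num.sqrt Q by rewrite sqrtr_gt0 lt_def q0.
  rewrite -sqP ler_pXn2r ?nnegrE ?rnorm_ge0 ?(ltW q0)//.
  by rewrite -(ler_pM2r q0) -expr2 sqP.
apply/ler_addgt0Pl => e e0.
(* This tolerance gets multiplied by norms that sum to [P], so at most [e] is lost in total. *)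
have e'0 : 0 < e / (P + 1) by rewrite divr_gt0// ltr_wpDl.
have /choice[v vP] (i : I) : exists v : V, rnorm v <= 1 /\
    exists2 c : R, dual_coord i v = c%:C & rnorm (dual_coord i) - e / (P + 1) <= c.
  by have [v v1 vc] := dual_near_norming (dual_coord i) e'0; exists v.
have /choice[c cP] (i : I) : exists c : R, dual_coord i (v i) = c%:C /\
    rnorm (dual_coord i) - e / (P + 1) <= c.
  by have [_ [c ? ?]] := vP i; exists c.
pose y i := (rnorm (dual_coord i))%:C *: v i.
have phiy : phi (l2_fin s y) = (\sum_(i <- s) rnorm (dual_coord i) * c i)%:C.
  rewrite bop_l2_fin rmorph_sum /=; apply: eq_bigr => i _.
  rewrite -[LHS]/(dual_coord i (y i)).
  have -> : dual_coord i (y i) = (rnorm (dual_coord i))%:C * dual_coord i (v i).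
    by rewrite /y linearZ.
  by rewrite (cP i).1 rmorphM.
have phile : \sum_(i <- s) rnorm (dual_coord i) * c i <= rnorm phi * Num.sqrt Q.
  apply: (@le_trans _ _ (rnorm (phi (l2_fin s y)))).
    rewrite phiy.
    by rewrite rnormC ler_norm.
  apply: le_trans (rnorm_bop_le _ _) _; apply: ler_wpM2l; first exact: opnorm_ge0.
  rewrite -(@ler_pXn2r _ 2) ?nnegrE ?rnorm_ge0 ?sqrtr_ge0// sqP rnorm_l2_fin//.
  apply: ler_sum => i _; rewrite ler_pXn2r ?nnegrE ?rnorm_ge0//.
  have n0 := rnorm_ge0 (dual_coord i).
  rewrite /y rnormZ -[complex.Re _]/(@rnorm R R[i]^o _) rnormC ger0_norm//.
  by rewrite ler_piMr// (vP i).1.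
apply: (@le_trans _ _ (e / (P + 1) * P + \sum_(i <- s) rnorm (dual_coord i) * c i)).
  rewrite /P mulr_sumr -big_split /=; apply: ler_sum => i _.
  rewrite mulrC -mulrDr expr2 ler_wpM2l ?rnorm_ge0// -lerBlDl; exact: (cP i).2.
rewrite lerD// mulrAC ler_pdivrMr ?ltr_wpDl//.
by rewrite ler_wpM2l ?lerDl// ltW.
Qed.

Lemma dual_coords_subproof : dual_coord \in @sqsummable R I (dual V).
Proof.
apply: le_lt_trans (ltry (rnorm phi ^+ 2)).
by apply: sqsum_le_fin; exact: sum_dual_coord_le.
Qed.

Definition dual_coords : l2 I (dual V) := MkL2 dual_coords_subproof.

(** One inequality is [sum_dual_coord_le]; the other is Cauchy-Schwarz on truncations, extended by
    density. *)
Lemma rnorm_dual_coords : rnorm dual_coords = rnorm phi.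
Proof.
apply/le_anti/andP; split.
  apply: l2_norm_le; first exact: rnorm_ge0.
  by apply: sqsum_le_fin; exact: sum_dual_coord_le.
apply: opnorm_le => [|x]; first exact: rnorm_ge0.
apply: bop_l2_fin_le => s us; rewrite bop_l2_fin.
apply: (@le_trans _ _ (\sum_(i <- s) rnorm (dual_coord i) * rnorm (x i))).
  elim: s {us} => [|i s IH]; first by rewrite !big_nil rnorm0.
  rewrite !big_cons; apply: le_trans (ler_rnormD _ _) _.
  by apply: lerD IH; exact: (rnorm_bop_le (dual_coord i)).
apply: sum_mul_le; rewrite ?rnorm_ge0//.
- by rewrite -lee_fin rnorm_sqr_l2; exact: (@sum_le_sqsum R I (dual V) dual_coords).
- by rewrite -lee_fin rnorm_sqr_l2; exact: sum_le_sqsum.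
Qed.

End DualCoordinates.

(** * Tridiagonal operators *)

Section Additivity.
Variables (R : realType).

Lemma bop_ext (V W : normedModType R[i]) (S T : bop V W) : (forall x, S x = T x) -> S = T.
Proof. by move=> ST; apply/val_inj/funext. Qed.

Lemma bopB (V W : normedModType R[i]) (S T : bop V W) x : (S - T) x = S x - T x.
Proof. by []. Qed.

Lemma bopZ (V W : normedModType R[i]) a (T : bop V W) x : (a *: T) x = a *: T x.
Proof. by []. Qed.

Lemma l2D (I : choiceType) (V : normedModType R[i]) (x y : l2 I V) i : (x + y) i = x i + y i.
Proof. by []. Qed.

Lemma l2B (I : choiceType) (V : normedModType R[i]) (x y : l2 I V) i : (x - y) i = x i - y i.
Proof. by []. Qed.

Lemma l2Z (I : choiceType) (V : normedModType R[i]) a (x : l2 I V) i : (a *: x) i = a *: x i.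
Proof. by []. Qed.

Lemma bop_l2D3 (I : choiceType) (V W : normedModType R[i]) (A B C : bop V (l2 I W)) x i :
  (A + B + C) x i = A x i + B x i + C x i.
Proof. by []. Qed.

End Additivity.

Section Diagonals.
Variables (R : realType) (V : normedModType R[i]) (B : bop (l2 int V) (l2 int V)).

Lemma diag_has_sup (s : int) : has_sup [set rnorm (entry B (i + s) i) | i in [set: int]].
Proof.
split; first by exists (rnorm (entry B (0 + s) 0)), 0.
by exists (opnorm B) => _ [i _ <-]; exact: opnorm_entry_le.
Qed.

Lemma entry_le_sup (s i : int) :
  rnorm (entry B (i + s) i) <= sup [set rnorm (entry B (j + s) j) | j in [set: int]].
Proof. by apply: sup_upper_bound; [exact: diag_has_sup|exists i]. Qed.

Lemma sup_diag_ge0 (s : int) : 0 <= sup [set rnorm (entry B (i + s) i) | i in [set: int]].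
Proof. exact: le_trans (rnorm_ge0 _) (entry_le_sup s 0). Qed.

Lemma offdiag_norm_ge0 : 0 <= offdiag_norm B.
Proof. by rewrite addr_ge0 ?sup_diag_ge0. Qed.

Lemma offdiag_norm_le : offdiag_norm B <= opnorm B + opnorm B.
Proof.
by apply: lerD; apply: ge_sup; [exact: (diag_has_sup 1).1| |exact: (diag_has_sup (-1)).1|];
  move=> _ [i _ <-]; exact: opnorm_entry_le.
Qed.

End Diagonals.

Section Tridiagonal.
Variables (R : realType) (V : normedModType R[i]) (B : bop (l2 int V) (l2 int V)).
Hypothesis B1 : has_bandwidth 1 B.

(** Both sides are bounded operators in [x] that agree on single vectors, and finitely supported
    vectors are dense. *)
Lemma tridiagE (x : l2 int V) (i : int) :
  B x i = entry B i (i - 1) (x (i - 1)) + entry B i i (x i) + entry B i (i + 1) (x (i + 1)).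
Proof.
pose T := bcomp (l2_coord V i) B -
  (bcomp (entry B i (i - 1)) (l2_coord V (i - 1)) + bcomp (entry B i i) (l2_coord V i)
   + bcomp (entry B i (i + 1)) (l2_coord V (i + 1))).
apply/eqP; rewrite -subr_eq0; apply/eqP; rewrite -[LHS]/(T x).
apply: bop_single_eq0 => j.
set v := x j.
rewrite -[LHS]/(entry B i j v - (entry B i (i - 1) (l2_single_fun j v (i - 1)) +
  entry B i i (l2_single_fun j v i) + entry B i (i + 1) (l2_single_fun j v (i + 1)))).
apply/eqP; rewrite subr_eq0; apply/eqP; rewrite /l2_single_fun.
have [ij|ij] := leP `|i - j| 1; last first.
  rewrite (B1 ij) !ifF ?linear0 ?addr0//; lia.
move: ij; rewrite ler_norml => /andP[ij1 ij2].
have : [|| j == i - 1, j == i | j == i + 1] by lia.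
case/or3P => /eqP ->.
- by rewrite eqxx ifF ?ifF ?linear0 ?addr0//; lia.
- by rewrite eqxx ifF ?[in X in _ + X]ifF ?linear0 ?add0r ?addr0//; lia.
- by rewrite eqxx ifF ?ifF ?linear0 ?add0r//; lia.
Qed.

Lemma tridiag_single (i : int) v : B (l2_single i v) =
  l2_single (i - 1) (entry B (i - 1) i v) + l2_single i (entry B i i v) +
  l2_single (i + 1) (entry B (i + 1) i v).
Proof.
apply: l2_ext => j; rewrite -[LHS]/(entry B j i v).
rewrite -[RHS]/(l2_single_fun (i - 1) (entry B (i - 1) i v) j +
  l2_single_fun i (entry B i i v) j + l2_single_fun (i + 1) (entry B (i + 1) i v) j).
rewrite /l2_single_fun.
have [ij|ij] := leP `|j - i| 1; last first.
  rewrite (B1 ij) !ifF ?addr0//; lia.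
move: ij; rewrite ler_norml => /andP[ij1 ij2].
have : [|| j == i - 1, j == i | j == i + 1] by lia.
case/or3P => /eqP ->.
- by rewrite eqxx ifF ?ifF ?addr0//; lia.
- by rewrite eqxx ifF ?[in X in _ + X]ifF ?add0r ?addr0//; lia.
- by rewrite eqxx ifF ?ifF ?add0r//; lia.
Qed.

(** Through [dual_coords], [tridiag_adjoint] is the true Banach space adjoint, so bounds on
    sequences and bounds on functionals can be exchanged. *)
Lemma tridiag_adjoint_coords (phi : dual (l2 int V)) :
  tridiag_adjoint B (dual_coords phi) = dual_coords (badjoint B phi).
Proof.
apply: l2_ext => i; apply: bop_ext => v.
have E s : adjoint_diag B s (dual_coords phi) i v =
    phi (l2_single (i + s) (entry B (i + s) i v)) by [].
have F : dual_coords (badjoint B phi) i v = phi (B (l2_single i v)) by [].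
have H x y z : phi (x + y + z) = phi x + phi y + phi z by rewrite !linearD.
have G := bop_l2D3 (adjoint_diag B (-1)) (adjoint_diag B 0) (adjoint_diag B 1)
  (dual_coords phi) i.
rewrite -/(tridiag_adjoint B) in G.
rewrite F tridiag_single H {F H} [in LHS]G.
have bop3 (S T U : dual V) x : (S + T + U) x = S x + T x + U x by [].
by rewrite bop3 !E addr0.
Qed.

Lemma has_bandwidth_tridiag_adjoint : has_bandwidth 1 (tridiag_adjoint B).
Proof.
move=> i j ij; rewrite entry_tridiag_adjoint// B1 1?distrC//.
by apply: bop_ext => f; apply: bop_ext => v; exact: (linear0 f).
Qed.

(** Transposition exchanges the two off-diagonals, and adjoints of entries have no larger norm. *)
Lemma offdiag_adjoint_le :
  offdiag_norm (tridiag_adjoint B) <= offdiag_norm B.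
Proof.
rewrite /offdiag_norm addrC.
have adj_le t t' : t' = - t ->
    sup [set rnorm (entry (tridiag_adjoint B) (i + t) i) | i in [set: int]] <=
    sup [set rnorm (entry B (i + t') i) | i in [set: int]].
  move=> ->; apply: ge_sup; first exact: (diag_has_sup _ t).1.
  move=> _ [i _ <-]; rewrite entry_tridiag_adjoint//.
  apply: le_trans (opnorm_badjoint_le _) _.
  by have := entry_le_sup B (- t) (i + t); rewrite addrK.
by apply: lerD; apply: adj_le.
Qed.

End Tridiagonal.

Section FiniteFunctionals.
Variables (R : realType) (V : normedModType R[i]).

Lemma dual_coords_fin (I : choiceType) (s : seq I) (f : l2 I (dual V)) : uniq s ->
  (forall i, i \notin s -> f i = 0) -> exists phi, dual_coords phi = f.
Proof.
move=> us f0; exists (\sum_(i <- s) (bcomp (f i) (l2_coord V i) : dual (l2 I V))).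
apply: l2_ext => j; apply: bop_ext => v.
rewrite -[LHS]/(bop_fun (\sum_(i <- s) (bcomp (f i) (l2_coord V i) : dual (l2 I V)))
  (l2_single j v)).
transitivity (\sum_(i <- s) f i (l2_single_fun j v i)).
  by elim/big_ind2 : _ => // S a T b <- <-.
rewrite /l2_single_fun; have [js|js] := boolP (j \in s).
  rewrite (bigD1_seq j)//= eqxx big1 ?addr0// => i ij.
  by rewrite (negPf ij) linear0.
rewrite (f0 _ js) big_seq big1// => i si.
by case: eqP => [ij|_]; rewrite ?linear0//; move: js; rewrite -ij si.
Qed.

(** Window-supported sequences have finite support. This is the surjectivity needed to restrict a
    bound on functionals to windows. *)
Lemma window_dual_coords n k (f : l2 int (dual V)) : window n k f ->
  exists phi, dual_coords phi = f.
Proof.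
move=> wf; pose s := [seq k + 1 + m%:Z | m <- iota 0 n].
apply: (@dual_coords_fin _ s).
  by rewrite map_inj_uniq ?iota_uniq// => a b; lia.
move=> i si; apply: wf; apply: contra si => ki; apply/mapP.
by exists (absz (i - (k + 1))%R); rewrite ?mem_iota; lia.
Qed.

End FiniteFunctionals.

(** * Localization to windows *)

Section SineWeights.
Variable R : realType.

(* Summation by parts: the sine weights are the Dirichlet ground state of the discrete
   Laplacian on a path with [n] vertices. *)
Lemma sum_sqr_diff_sin (t : R) N :
  \sum_(m < N) (sin (m.+1%:R * t) - sin (m%:R * t)) ^+ 2 =
  2 * (1 - cos t) * \sum_(m < N) sin (m%:R * t) ^+ 2 +
  sin (N%:R * t) * (sin (N%:R * t) - sin ((N%:R - 1) * t)).
Proof.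
elim: N => [|N IH]; first by rewrite !big_ord0 mul0r sin0 mul0r mulr0 addr0.
rewrite !big_ord_recr /= {}IH.
have e1 : sin (N.+1%:R * t) = sin (N%:R * t) * cos t + cos (N%:R * t) * sin t.
  by rewrite -natr1 mulrDl mul1r sinD.
have e2 : sin ((N%:R - 1) * t) = sin (N%:R * t) * cos t - cos (N%:R * t) * sin t.
  by rewrite mulrBl mul1r sinB.
have -> : N.+1%:R - 1 = N%:R :> R by rewrite -natr1 addrK.
by rewrite e1 e2; ring.
Qed.

(** Half-angle form of the eigenvalue in [sum_sqr_diff_sin]: at the angle [pi / n.+1%:R] it becomes
    [gap n ^+ 2]. *)
Lemma chord_sqr (u : R) : 2 * (1 - cos (u *+ 2)) = (2 * sin u) ^+ 2.
Proof. by rewrite cos_mulr2n cos2sin2 mulr2n; ring. Qed.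

(** The range includes 0 and [n.+1], where the sine vanishes, so that the formula also covers the
    neighbours of the [n] vertices. *)
Definition sine_weight n (m : int) : R :=
  if 0 <= m <= n.+1%:Z then sin (`|m|%N%:R * (pi / n.+1%:R)) else 0.

Lemma sine_weight_out n (m : int) : ~~ (1 <= m <= n%:Z) -> sine_weight n m = 0.
Proof.
rewrite /sine_weight => m1n; case: ifP => // m0.
have : (m == 0) || (m == n.+1%:Z) by lia.
case/orP => /eqP -> /=; first by rewrite mul0r sin0.
by rewrite mulrC divfK ?pnatr_eq0// sinpi.
Qed.

End SineWeights.

Lemma esum_int_range (R : realType) (a : int -> R) n : (forall m, 0 <= a m) ->
  (forall m : int, ~~ (0 <= m < n%:Z) -> a m = 0) ->
  \esum_(m in [set: int]) (a m)%:E = (\sum_(m < n) a m%:Z)%:E.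
Proof.
move=> a0 aout.
have -> : (\sum_(m < n) a m%:Z)%:E = \sum_(m <- [seq j%:Z | j <- iota 0 n]) (a m)%:E.
  by rewrite sumEFin big_map -(big_mkord xpredT (fun m => a m%:Z)) /index_iota subn0.
have us : uniq [seq j%:Z | j <- iota 0 n] by rewrite map_inj_uniq ?iota_uniq// => i j; lia.
rewrite fsbig_seq// -esum_fset//; last by move=> i _; rewrite lee_fin.
rewrite [RHS]esum_mkcond; apply: eq_esum => i _.
rewrite mem_setE; case: ifP => // /negbT si; rewrite aout//.
apply: contra si => ki; apply/mapP.
by exists (absz i); rewrite ?mem_iota; lia.
Qed.

Section PairSums.
Variables (R : realType) (V : normedModType R[i]).

Lemma esumZ (I : choiceType) (c : R) (f : I -> \bar R) : 0 <= c ->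
  (forall i, 0 <= f i)%E ->
  (\esum_(i in setT) (c%:E * f i) = c%:E * \esum_(i in setT) f i)%E.
Proof.
move=> c0 f0; apply/le_anti; rewrite esum_scale_le//=.
have [->|cn0] := eqVneq c 0.
  by rewrite mul0e esum_ge0// => i _; rewrite mule_ge0.
have cp : 0 < c by rewrite lt_def cn0.
rewrite -lee_pdivlMl//.
have := @esum_scale_le R I c^-1 (fun i => c%:E * f i)%E.
under eq_esum do rewrite muleA -EFinM mulVf// mul1e.
by apply; [rewrite invr_ge0|move=> i; rewrite mule_ge0].
Qed.

(* With [i = k + m], the double sum over [k] and [i] is a double sum over [m] and [i]. *)
Lemma sqsum_translates (a : int -> R) (S : R) (y : int -> V) :
  \esum_(m in [set: int]) (a m ^+ 2)%:E = S%:E ->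
  sqsum (fun p : int * int => ((a (p.2 - p.1))%:C)%C *: y p.2) =
  (S%:E * sqsum y)%E.
Proof.
move=> aS; have S0 : 0 <= S.
  by rewrite -lee_fin -aS; apply: esum_ge0 => m _; rewrite lee_fin sqr_ge0.
rewrite /sqsum.
transitivity (\esum_(p in [set: int] `*`` (fun=> [set: int]))
    ((rnorm (y p.1) ^+ 2)%:E * (a p.2 ^+ 2)%:E)%E).
  rewrite [RHS](reindex_esum [set: int * int] _ (fun p => (p.2, p.2 - p.1))).
    apply: eq_esum => p _ /=; rewrite rnormZ exprMn mulrC EFinM.
    by rewrite -[complex.Re _]/(@rnorm R R[i]^o _) rnormC real_normK ?num_real.
  split => //.
    by move=> [k i] [k' i'] _ _ /= [-> h]; congr pair; lia.
  by move=> [i m] _; exists (i - m, i) => //=; congr pair; lia.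
rewrite -(@esum_esum _ _ _ setT (fun=> setT)
   (fun i m => (rnorm (y i) ^+ 2)%:E * (a m ^+ 2)%:E)%E); last first.
  by move=> i m _ _; rewrite -EFinM lee_fin mulr_ge0 ?sqr_ge0.
rewrite -esumZ// => [|i]; last by rewrite lee_fin sqr_ge0.
apply: eq_esum => i _; rewrite esumZ ?sqr_ge0// => [|m]; last by rewrite lee_fin sqr_ge0.
by rewrite aS muleC.
Qed.

(** All translates are gathered in one vector over pairs, so that the triangle inequality applies to
    them at once. *)
Lemma l2_translates (a : int -> R) (S M : R) (y : int -> V) :
  \esum_(m in [set: int]) (a m ^+ 2)%:E = (S ^+ 2)%:E -> 0 <= S -> 0 <= M ->
  (sqsum y <= (M ^+ 2)%:E)%E ->
  exists2 F : l2 (int * int)%type V,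
    forall k i, F (k, i) = ((a (i - k))%:C)%C *: y i & rnorm F <= S * M.
Proof.
move=> aS S0 M0 yM.
have FM : (sqsum (fun p : int * int => (((a (p.2 - p.1))%:C)%C *: y p.2)%R) <= ((S * M) ^+ 2)%:E)%E.
  rewrite (sqsum_translates _ aS) exprMn [leRHS]EFinM.
  by apply: lee_wpmul2l; rewrite ?lee_fin ?sqr_ge0.
exists (MkL2 (le_lt_trans FM (ltry _) : _ \in @sqsummable R (int * int)%type V)) => //.
by apply: l2_norm_le; rewrite ?mulr_ge0.
Qed.

End PairSums.

(** Here [a], [b], [c] will be the terms of a row applied to a cut vector, and [p], [q] the outer
    terms with the central weight; the last two differences form the commutator. *)
Lemma addr_telescope (U : zmodType) (a b c p q : U) :
  a + b + c = p + b + q + (a - p) + (c - q).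
Proof.
rewrite [p + b + q + _]addrC [_ + (p + b + q)]addrA [_ + (p + b)]addrA subrK.
by rewrite [RHS]addrC -[RHS]addrA [_ + q]addrC addKr addrC.
Qed.

Section Windows.
Local Open Scope complex_scope.
Variables (R : realType) (V : normedModType R[i]).
Implicit Types (B : bop (l2 int V) (l2 int V)) (n : nat) (k : int).

(** For [0 < n], the square root of the smallest eigenvalue of the Dirichlet Laplacian on a path
    with [n] vertices. *)
Definition gap n : R := 2 * sin (pi / (2 * n.+1%:R)).

Lemma gap_angle n : pi / n.+1%:R = (pi / (2 * n.+1%:R)) *+ 2 :> R.
Proof.
have m0 : n.+1%:R != 0 :> R by rewrite pnatr_eq0.
by rewrite mulr2n; move: (_%:R) m0 => m m0; field.
Qed.

Lemma gap_ge0 n : 0 <= gap n.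
Proof.
rewrite mulr_ge0// sin_ge0_pi// divr_ge0 ?pi_ge0 ?mulr_ge0//=.
by rewrite ler_piMr ?pi_ge0// invf_le1 ?mulr_gt0// -natrM ler1n.
Qed.

Lemma sine_weight_sum n : (0 < n)%N -> exists2 S : R, 0 < S &
  [/\ \esum_(m in [set: int]) (sine_weight R n m ^+ 2)%:E = (S ^+ 2)%:E,
      \esum_(m in [set: int]) ((sine_weight R n (m - 1) - sine_weight R n m) ^+ 2)%:E
        = ((gap n * S) ^+ 2)%:E &
      \esum_(m in [set: int]) ((sine_weight R n (m + 1) - sine_weight R n m) ^+ 2)%:E
        = ((gap n * S) ^+ 2)%:E].
Proof.
move=> n0; set t : R := pi / n.+1%:R.
have wE (m : nat) : (m <= n.+1)%N -> sine_weight R n m%:Z = sin (m%:R * t).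
  by move=> mn; rewrite /sine_weight ifT//; lia.
have wout m := @sine_weight_out R n m.
pose Q := \sum_(m < n.+1) sin (m%:R * t) ^+ 2.
have sinpi' : sin (n.+1%:R * t) = 0 by rewrite mulrC divfK ?pnatr_eq0// sinpi.
(* The term of index 1 is positive, since [0 < n] puts [t] strictly between 0 and [pi]. *)
have Q0 : 0 < Q.
  rewrite /Q big_ord_recl ltr_wpDl ?sqr_ge0//.
  case: n n0 {wE wout Q sinpi'} @t => // n _ t; rewrite big_ord_recl ltr_pwDl//.
    rewrite exprn_gt0// mul1r sin_gt0_pi// divr_gt0 ?pi_gt0//=.
    by rewrite ltr_pdivrMr// ltr_pMr ?pi_gt0// ltr1n.
  by apply: sumr_ge0 => i _; exact: sqr_ge0.
have sS : \esum_(m in [set: int]) (sine_weight R n m ^+ 2)%:E = Q%:E.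
  rewrite (@esum_int_range _ _ n.+1) => [|m|m mn]; [|exact: sqr_ge0|]; last first.
    by rewrite wout ?expr0n//; lia.
  by congr EFin; apply: eq_bigr => m _; rewrite wE// ltnW.
have sD : \esum_(m in [set: int]) ((sine_weight R n (m - 1) - sine_weight R n m) ^+ 2)%:E
    = (gap n ^+ 2 * Q)%:E.
  rewrite (@esum_int_range _ _ n.+2) => [|m|m mn]; [|exact: sqr_ge0|]; last first.
    by rewrite !wout ?subrr ?expr0n//; lia.
  (* The term of index 0 vanishes because the weights at -1 and 0 do. *)
  congr EFin; rewrite big_ord_recl !wout// subrr expr0n add0r.
  transitivity (\sum_(m < n.+1) (sin (m.+1%:R * t) - sin (m%:R * t)) ^+ 2).
    apply: eq_bigr => m _; rewrite -sqrrN opprB lift0 -(wE m.+1)// -(wE m)//; last exact: ltnW.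
    by congr ((_ - sine_weight R n _) ^+ 2); lia.
  by rewrite sum_sqr_diff_sin sinpi' mul0r addr0 -/Q /t gap_angle chord_sqr.
exists (Num.sqrt Q); first by rewrite sqrtr_gt0.
rewrite exprMn sqr_sqrtr ?(ltW Q0)//; split => //.
(* Forward differences are backward ones, shifted by one index and with opposite sign. *)
rewrite -sD [RHS](reindex_esum [set: int] _ (fun m => m + 1)).
  by apply: eq_esum => m _; rewrite addrK -sqrrN opprB.
split=> // [i j _ _ /addIr//|m _]; by exists (m - 1) => //; rewrite subrK.
Qed.

Lemma sqsum_offdiag B (j : int -> int) (x : l2 int V) b : injective j -> 0 <= b ->
  (forall i, rnorm (entry B i (j i)) <= b) ->
  (sqsum (fun i => entry B i (j i) (x (j i))) <= ((b * rnorm x) ^+ 2)%:E)%E.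
Proof.
move=> ji b0 Bb.
pose xj (i : int) : V := oapp x 0 (Some (j i)).
have : (sqsum (fun i => entry B i (j i) (x (j i))) <= (b ^+ 2)%:E * sqsum xj)%E.
  apply: sqsum_le_scale => // i; apply: le_trans (rnorm_bop_le _ _) _.
  by rewrite ler_wpM2r ?rnorm_ge0//; exact: Bb.
move=> /le_trans; apply; rewrite exprMn [leRHS]EFinM rnorm_sqr_l2; apply: lee_wpmul2l.
  by rewrite lee_fin sqr_ge0.
by apply: (@sqsum_reindex R V _ _ (Some \o j)) => i i' m [<-] [] /ji.
Qed.

(* Averaging over all translates of the sine weight [w]: the commutator of [B] with the
   multiplication by [w (. - k)] only involves differences of neighbouring weights, whose
   squares sum to [gap n ^+ 2] times the sum of the squares of [w]. *)
Lemma window_lower_bound n B c : (0 < n)%N -> has_bandwidth 1 B -> 0 <= c ->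
  (forall k x, window n k x -> c * rnorm x <= rnorm (B x)) ->
  forall x, c * rnorm x <= rnorm (B x) + eps_pp n B * rnorm x.
Proof.
move=> n0 B1 c0 Bc x.
have [S S0 [sS sD sD']] := sine_weight_sum n0.
set w := sine_weight R n in sS sD sD'.
have xx : (sqsum x <= (rnorm x ^+ 2)%:E)%E by rewrite rnorm_sqr_l2.
have BB : (sqsum (B x) <= (rnorm (B x) ^+ 2)%:E)%E by rewrite rnorm_sqr_l2.
have G0 : 0 <= gap n * S by rewrite mulr_ge0 ?gap_ge0// ltW.
pose b1 := sup [set rnorm (entry B (i + 1) i) | i in [set: int]].
pose b2 := sup [set rnorm (entry B (i - 1) i) | i in [set: int]].
have Bb1 i : rnorm (entry B i (i - 1)) <= b1.
  by have := entry_le_sup B 1 (i - 1); rewrite subrK.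
have Bb2 i : rnorm (entry B i (i + 1)) <= b2.
  by have := entry_le_sup B (-1) (i + 1); rewrite addrK.
have b1_0 : 0 <= b1 := sup_diag_ge0 B 1.
have b2_0 : 0 <= b2 := sup_diag_ge0 B (-1).
(* [U] holds all translated cut-offs of [x], [F] those of [B x], and [F'], [F''] the commutator
   terms of the lower and the upper diagonal. *)
have [U UE _] := l2_translates sS (ltW S0) (rnorm_ge0 x) xx.
have [F FE F1] := l2_translates sS (ltW S0) (rnorm_ge0 (B x)) BB.
have [F' F'E F'1] := l2_translates sD G0 (mulr_ge0 b1_0 (rnorm_ge0 x))
  (sqsum_offdiag x (addIr (-1)) b1_0 Bb1).
have [F'' F''E F''1] := l2_translates sD' G0 (mulr_ge0 b2_0 (rnorm_ge0 x))
  (sqsum_offdiag x (addIr 1) b2_0 Bb2).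
have Usub k : (fun i : int => U (k, i)) \in @sqsummable R int V.
  apply: le_lt_trans (ltry (rnorm U ^+ 2)); rewrite rnorm_sqr_l2.
  by apply: (@sqsum_reindex R V _ _ (fun i => Some (k, i)) U) => i i' m [<-] [].
pose u k : l2 int V := MkL2 (Usub k).
have Buk k i : B (u k) i = (F + F' + F'') (k, i).
  rewrite !l2D tridiagE// FE F'E F''E (tridiagE B1 x).
  rewrite -![l2_fun (u k) _]/(U (k, _)) !UE !linearZ /= !scalerDr !rmorphB !scalerBl.
  have -> : i - 1 - k = i - k - 1 by lia.
  have -> : i + 1 - k = i - k + 1 by lia.
  exact: addr_telescope.
have uU : sqsum u = sqsum U.
  by rewrite sqsum_pairs; congr (@sqsum R (int * int)%type V); apply/funext => -[].
have BuF : sqsum (fun k => B (u k)) = (rnorm (F + F' + F'') ^+ 2)%:E.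
  rewrite sqsum_pairs rnorm_sqr_l2; congr (@sqsum R (int * int)%type V).
  by apply/funext => -[k i] /=; exact: Buk.
have su : sqsum u = ((S * rnorm x) ^+ 2)%:E.
  rewrite exprMn [RHS]EFinM rnorm_sqr_l2 -(sqsum_translates _ sS) uU.
  by congr (@sqsum R (int * int)%type V); apply/funext => -[k i] /=; exact: UE.
have uw k : window n k (u k).
  move=> i ik; rewrite -[LHS]/(U (k, i)) UE /w sine_weight_out ?scale0r//.
  lia.
(* Square the window bounds for the [u k] and sum over [k]. *)
have Bu : c * (S * rnorm x) <= rnorm (F + F' + F'').
  rewrite -(@ler_pXn2r _ 2) ?nnegrE ?rnorm_ge0 ?mulr_ge0 ?rnorm_ge0// ?(ltW S0)//.
  rewrite -lee_fin -BuF [(c * _) ^+ 2]exprMn EFinM -su -esumZ ?sqr_ge0//; last first.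
    by move=> k; rewrite lee_fin sqr_ge0.
  apply: le_esum => k _; rewrite -EFinM lee_fin -exprMn.
  by rewrite ler_pXn2r ?nnegrE ?rnorm_ge0 ?mulr_ge0 ?rnorm_ge0//; exact: Bc (uw k).
rewrite -(ler_pM2l S0) mulrCA; apply: le_trans Bu _.
apply: le_trans (ler_rnormD _ _) _; apply: le_trans (lerD (ler_rnormD _ _) (lexx _)) _.
apply: le_trans (lerD (lerD F1 F'1) F''1) _.
rewrite /eps_pp /gap le_eqVlt; apply/orP; left; apply/eqP.
by rewrite /offdiag_norm -/b1 -/b2; ring.
Qed.

End Windows.

(** * Completeness, separation and invertibility *)

Section Completeness.
Variable R : realType.

Definition rcomplete (V : normedModType R[i]) : Prop := forall u : nat -> V,
  (forall e : R, 0 < e -> exists N, forall m n, (N <= m)%N -> (N <= n)%N ->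
     rnorm (u m - u n) <= e) ->
  exists x, forall e : R, 0 < e -> exists N, forall n, (N <= n)%N -> rnorm (u n - x) <= e.

Lemma complete_rcomplete (X : completeNormedModType R[i]) : rcomplete X.
Proof.
move=> u uC.
have : cvgn u.
  apply: cauchy_cvg; apply/cauchy_exP => e e0.
  have e'0 : 0 < complex.Re e by move: e0; rewrite ltcE => /andP[].
  have [N NP] := uC _ (divr_gt0 e'0 (ltr0Sn R 1)).
  exists (u N); exists N => // n /= Nn; rewrite -ball_normE /ball_ /=.
  rewrite rnormE; case: e e0 e'0 NP => a b /=; rewrite ltcE /= => /andP[/eqP -> _] a0 NP.
  by rewrite ltcE /= eqxx /= (le_lt_trans (NP _ _ (leqnn N) Nn))// ltr_pdivrMr// ltr_pMr// ltr1n.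
move=> /cvg_ex[x /cvgr_dist_le ux]; exists x => e e0.
have [|N _ NP] := ux (e%:C)%C; first by rewrite ltcR.
by exists N => n Nn; have := NP n Nn; rewrite /= distrC rnormE lecR.
Qed.

(** Coordinatewise limits give the candidate [x]; the Cauchy bound on finite sums survives the limit
    and so bounds the full sum. *)
Lemma l2_rcomplete (I : choiceType) (V : normedModType R[i]) :
  rcomplete V -> rcomplete (l2 I V).
Proof.
move=> cV u uC.
have /choice[x xP] (i : I) : exists x : V, forall e : R, 0 < e ->
    exists N, forall n, (N <= n)%N -> rnorm (u n i - x) <= e.
  apply: (cV (fun n => u n i)) => e e0; have [N NP] := uC e e0.
  exists N => m n Nm Nn; rewrite -l2B; apply: le_trans (NP m n Nm Nn).
  by rewrite rnorm_l2E; exact: rnorm_coord_le.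
have fin_cvg (s : seq I) (e : R) : 0 < e ->
    exists N, forall n, (N <= n)%N -> \sum_(i <- s) rnorm (u n i - x i) <= e.
  elim: s e => [|i s IH] e e0; first by exists 0%N => n _; rewrite big_nil ltW.
  have e20 : 0 < e / 2 by rewrite divr_gt0.
  have [N1 h1] := IH _ e20; have [N2 h2] := xP i _ e20.
  exists (maxn N1 N2) => n; rewrite geq_max => /andP[n1 n2].
  by rewrite big_cons (splitr e) lerD ?h1 ?h2.
have tail N (e : R) : 0 <= e ->
    (forall m n, (N <= m)%N -> (N <= n)%N -> rnorm (u m - u n) <= e) ->
    forall m, (N <= m)%N -> (sqsum (fun i => u m i - x i)%R <= (e ^+ 2)%:E)%E.
  move=> e0 NP m Nm; apply: sqsum_le_fin => s us.
  pose d n i := u n i - x i.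
  rewrite -(rnorm_l2_fin (d m))// ler_pXn2r ?nnegrE ?rnorm_ge0//.
  apply/ler_addgt0Pl => r r0.
  have [N' N'P] := fin_cvg s r r0.
  pose n := maxn N N'.
  have -> : l2_fin s (d m) = l2_fin s (d n) + l2_fin s (u m - u n).
    apply: l2_ext => j; rewrite l2D !l2_finE//; case: ifP => _; last by rewrite addr0.
    by rewrite l2B /d [RHS]addrC addrA subrK.
  apply: le_trans (ler_rnormD _ _) (lerD _ _).
    apply: le_trans (N'P n (leq_maxr _ _)).
    elim: (s) => [|i s' IH]; first by rewrite /l2_fin !big_nil rnorm0.
    rewrite /l2_fin !big_cons; apply: le_trans (ler_rnormD _ _) (lerD _ IH).
    exact: rnorm_l2_single_le.
  apply: le_trans (NP m n Nm (leq_maxl _ _)).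
  rewrite -(@ler_pXn2r _ 2) ?nnegrE ?rnorm_ge0// rnorm_l2_fin// -lee_fin rnorm_sqr_l2.
  exact: sum_le_sqsum.
have [N0 N0P] := uC 1 ltr01.
have dS : (fun i => u N0 i - x i) \in @sqsummable R I V.
  exact: le_lt_trans (tail _ _ ler01 N0P _ (leqnn _)) (ltry _).
(* The limit is [x], written as a difference of two square-summable sequences because [x] is not
   known to be one beforehand. *)
exists (u N0 - MkL2 dS) => e e0; have [N NP] := uC e e0.
exists N => n Nn; apply: l2_norm_le; first exact: ltW.
apply: le_trans (tail N e (ltW e0) NP n Nn).
apply: le_esum => i _; rewrite lee_fin !l2B /=.
by rewrite (_ : u N0 i - (u N0 i - x i) = x i)// opprB addrC subrK.
Qed.

End Completeness.

(** * A Hahn-Banach theorem for real sublinear functionals on a complex space *)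

Section HahnBanach.
Local Open Scope complex_scope.
Variables (R : realType) (V : lmodType R[i]).
Implicit Types (p q : V -> R) (x y : V) (F : V -> set R).

(** Only real scalars occur, since these functionals serve to build real parts of complex ones.
    Equality in the homogeneity follows by applying it to [s^-1] as well. *)
Definition sublinear q : Prop := (forall x y, q (x + y) <= q x + q y) /\
  (forall (s : R) x, 0 < s -> q (s%:C *: x) <= s * q x).

Lemma sublinear_inf F : (forall x, F x !=set0) -> (forall x, has_lbound (F x)) ->
  (forall x y a b, F x a -> F y b -> exists2 c, F (x + y) c & c <= a + b) ->
  (forall (s : R) x a, 0 < s -> F x a -> exists2 c, F (s%:C *: x) c & c <= s * a) ->
  sublinear (fun x => inf (F x)).
Proof.
move=> F0 Fb FD FZ; split=> [x y|s x s0].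
  rewrite -lerBlDr; apply: lb_le_inf (F0 x) _ => a Fa.
  rewrite lerBlDr -lerBlDl; apply: lb_le_inf (F0 y) _ => b Fb'.
  rewrite lerBlDl; have [c Fc cab] := FD _ _ _ _ Fa Fb'.
  exact: le_trans (ge_inf (Fb _) Fc) cab.
rewrite -ler_pdivrMl//; apply: lb_le_inf (F0 x) _ => a Fa; rewrite ler_pdivrMl//.
have [c Fc ca] := FZ _ _ _ s0 Fa.
exact: le_trans (ge_inf (Fb _) Fc) ca.
Qed.

Lemma sublinearZ q (s : R) x : sublinear q -> 0 < s -> q (s%:C *: x) = s * q x.
Proof.
move=> [_ qZ] s0; apply/le_anti; rewrite qZ//= mulrC -ler_pdivlMr// mulrC.
have s'0 : 0 < s^-1 by rewrite invr_gt0.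
have := qZ s^-1 (s%:C *: x) s'0.
by rewrite scalerA -rmorphM mulVf ?gt_eqF// scale1r.
Qed.

Lemma sublinear0 q : sublinear q -> q 0 = 0.
Proof.
move=> qs; have := @sublinearZ q 2 0 qs (ltr0Sn _ _).
by rewrite scaler0; lra.
Qed.

Lemma sublinear_opp q x : sublinear q -> - q (- x) <= q x.
Proof. by move=> qs; have := qs.1 x (- x); rewrite subrr sublinear0//; lra. Qed.

(* The largest sublinear functional below [q] that is additive along the ray of [y]. *)
Definition tilt q y x : R := inf [set q (x + t%:C *: y) - t * q y | t in [set t | 0 <= t]].

Section Tilt.
Variables (q : V -> R) (y : V).
Hypothesis qs : sublinear q.

Lemma sublinearZ0 (t : R) x : 0 <= t -> q (t%:C *: x) = t * q x.
Proof.
rewrite le_eqVlt => /predU1P[<-|/sublinearZ->//].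
by rewrite scale0r sublinear0// mul0r.
Qed.

Lemma tilt_lbound x : lbound [set q (x + t%:C *: y) - t * q y | t in [set t | 0 <= t]] (- q (- x)).
Proof.
move=> _ [t /= t0 <-]; have := qs.1 (x + t%:C *: y) (- x).
by rewrite addrAC subrr add0r sublinearZ0//; lra.
Qed.

Lemma tilt_le x (t : R) : 0 <= t -> tilt q y x <= q (x + t%:C *: y) - t * q y.
Proof. by move=> t0; apply: ge_inf; [exists (- q (- x)); exact: tilt_lbound|exists t]. Qed.

Lemma tilt_leq x : tilt q y x <= q x.
Proof. by have := tilt_le x (lexx 0); rewrite scale0r addr0 mul0r subr0. Qed.

Lemma sublinear_tilt : sublinear (tilt q y).
Proof.
apply: sublinear_inf => [x|x|x z a b|s x a s0].
- by exists (q (x + 0%:C *: y) - 0 * q y), 0 => /=.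
- by exists (- q (- x)); exact: tilt_lbound.
- move=> [t /= t0 <-] [t' /= t'0 <-].
  exists (q (x + z + (t + t')%:C *: y) - (t + t') * q y).
    by exists (t + t') => //=; rewrite addr_ge0.
  rewrite rmorphD scalerDl addrACA.
  by have := qs.1 (x + t%:C *: y) (z + t'%:C *: y); lra.
- move=> [t /= t0 <-].
  exists (q (s%:C *: x + (s * t)%:C *: y) - (s * t) * q y).
    by exists (s * t) => //=; rewrite mulr_ge0// ltW.
  by rewrite rmorphM -scalerA -scalerDr sublinearZ// mulrBr mulrA.
Qed.

End Tilt.

(* A minimal sublinear functional coincides with all its tilts, which makes it additive. *)
Lemma sublinear_minorant p y0 : sublinear p -> exists u : V -> R,
  [/\ forall x y, u (x + y) = u x + u y, forall (t : R) x, u (t%:C *: x) = t * u x,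
      forall x, u x <= p x & u y0 = p y0].
Proof.
move=> ps; (* Starting from the tilt of [p] along [y0] forces [u y0 = p y0]. *)
pose p' := tilt p y0.
have ps' : sublinear p' := sublinear_tilt y0 ps.
pose T := {q : V -> R | `[< sublinear q /\ forall x, q x <= p' x >]}.
(* The order is reversed, so that a maximal element is a minimal functional; [p'] bounds the empty
   chain and the pointwise infimum a nonempty one. *)
pose leT (q r : T) := `[< forall x, sval r x <= sval q x >].
have p'T : `[< sublinear p' /\ forall x, p' x <= p' x >] by apply/asboolP.
have [q|r s t /asboolP rs /asboolP st|[s sP] [t tP] /asboolP st /asboolP ts|A Atot
    |[u uP] /= umax] := @Zorn T leT.
- exact/asboolP.
- by apply/asboolP => x; exact: le_trans (st x) (rs x).
- apply: eq_exist; apply/funext => x; apply/le_anti.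
  by rewrite ts st.
- have [[q0 Aq0]|A0] := pselect (A !=set0); last first.
    by exists (exist _ p' p'T) => s As; exfalso; apply: A0; exists s.
  pose F x := [set sval q x | q in A].
  (* Each member satisfies [- q (- x) <= q x] and lies below [p'], so the infimum is finite. *)
  have Fb x : lbound (F x) (- p' (- x)).
    move=> _ [q Aq <-]; have /asboolP[qs qp] := svalP q.
    by apply: le_trans (sublinear_opp x qs); rewrite lerN2.
  have Fs : sublinear (fun x => inf (F x)).
    apply: sublinear_inf => [x|x|x y a b|s x a s0].
    + by exists (sval q0 x), q0.
    + by exists (- p' (- x)).
    + move=> [q Aq <-] [r Ar <-].
      have /asboolP[[qD _] _] := svalP q; have /asboolP[[rD _] _] := svalP r.
      have [/asboolP qr|/asboolP rq] := Atot _ _ Aq Ar.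
        exists (sval r (x + y)); first by exists r.
        by apply: le_trans (rD x y) _; rewrite lerD2r.
      exists (sval q (x + y)); first by exists q.
      by apply: le_trans (qD x y) _; rewrite lerD2l.
    + move=> [q Aq <-]; exists (sval q (s%:C *: x)); first by exists q.
      by have /asboolP[[_ qZ] _] := svalP q; exact: qZ.
  have FT : `[< sublinear (fun x => inf (F x)) /\ forall x, inf (F x) <= p' x >].
    apply/asboolP; split => // x; have /asboolP[_ qp] := svalP q0.
    by apply: le_trans (qp x); apply: ge_inf; [exists (- p' (- x))|exists q0].
  exists (exist _ (fun x => inf (F x)) FT) => q Aq; apply/asboolP => x /=.
  by apply: ge_inf; [exists (- p' (- x))|exists q].
- have /asboolP[us up'] := uP.
  have utilt y : tilt u y = u.
    have tP : `[< sublinear (tilt u y) /\ forall x, tilt u y x <= p' x >].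
      apply/asboolP; split; first exact: sublinear_tilt.
      by move=> x; apply: le_trans (tilt_leq y us x) (up' x).
    have := umax (exist _ (tilt u y) tP).
    rewrite /leT /= => /(_ _)/(congr1 sval) /=; apply.
    by apply/asboolP => x; exact: tilt_leq.
  have uD x y : u (x + y) = u x + u y.
    apply/le_anti; rewrite us.1 /=.
    have := tilt_le y us x ler01.
    by rewrite utilt scale1r mul1r; lra.
  have uN x : u (- x) = - u x.
    by have := uD x (- x); rewrite subrr sublinear0//; lra.
  exists u; split => //.
  + move=> t x; have [t0|t0|->] := ltgtP t 0.
    * have nt0 : 0 < - t by rewrite oppr_gt0.
      rewrite -[t in LHS]opprK rmorphN scaleNr uN sublinearZ//.
      by rewrite mulNr opprK.
    * exact: sublinearZ.
    * by rewrite scale0r sublinear0// mul0r.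
  + by move=> x; apply: le_trans (up' x) (tilt_leq y0 ps x).
  (* The tilt of [p] at [- y0], evaluated with [t = 1], gives [u (- y0) <= - p y0]. *)
  + apply/le_anti; rewrite (le_trans (up' y0) (tilt_leq y0 ps y0))/=.
    have := le_trans (up' (- y0)) (tilt_le y0 ps (- y0) ler01).
    by rewrite scale1r addNr sublinear0// mul1r uN; lra.
Qed.

End HahnBanach.

Section Separation.
Local Open Scope complex_scope.
Variables (R : realType) (V W : normedModType R[i]) (T : bop V W).

Definition range_dist (y : W) : R := inf [set rnorm (y - T z) | z in [set: V]].

Lemma range_dist_le y z : range_dist y <= rnorm (y - T z).
Proof.
by apply: ge_inf; [exists 0 => _ [w _ <-]; exact: rnorm_ge0|exists z].
Qed.

Lemma range_dist_ge0 y : 0 <= range_dist y.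
Proof.
apply: lb_le_inf; first by exists (rnorm (y - T 0)), 0.
by move=> _ [z _ <-]; exact: rnorm_ge0.
Qed.

Lemma sublinear_range_dist : sublinear range_dist.
Proof.
apply: sublinear_inf => [x|x|x y a b|s x a s0].
- by exists (rnorm (x - T 0)), 0.
- by exists 0 => _ [w _ <-]; exact: rnorm_ge0.
- move=> [z _ <-] [w _ <-]; exists (rnorm (x + y - T (z + w))); first by exists (z + w).
  by rewrite linearD opprD addrACA; exact: ler_rnormD.
- move=> [z _ <-]; exists (rnorm (s%:C *: x - T (s%:C *: z))); first by exists (s%:C *: z).
  rewrite linearZ -scalerBr rnormZ -[complex.Re _]/(@rnorm R R[i]^o _) rnormC.
  by rewrite ger0_norm// ltW.
Qed.

(** Apply Hahn-Banach to the distance to the range: a real functional below it is dominated by the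
    norm, hence continuous, and vanishes on the range because the distance does. *)
Lemma range_separation y : 0 < range_dist y ->
  exists phi : dual W, phi y != 0 /\ forall z, phi (T z) = 0.
Proof.
move=> y0; have [u [uD uZ up uy]] := sublinear_minorant y sublinear_range_dist.
have uN x : u (- x) = - u x.
  have := uZ (-1) x; rewrite mulN1r => <-.
  by rewrite rmorphN rmorph1 scaleN1r.
(* A complex-linear functional is determined by its real part [u]. *)
pose f (x : W) : R[i]^o := (u x +i* - u ('i *: x)).
have fl : linear f.
  move=> [a1 a2] x z; rewrite /f; apply/eqP; rewrite eq_complex /=.
  have aE v : (a1 +i* a2) *: v = a1%:C *: v + a2%:C *: ('i *: v).
    rewrite scalerA -scalerDl; congr (_ *: _).
    by apply/eqP; rewrite eq_complex /=; apply/andP; split; apply/eqP; ring.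
  have iE v : 'i *: ((a1 +i* a2) *: v) = a1%:C *: ('i *: v) + - (a2%:C *: v).
    rewrite !scalerA -scaleNr -scalerDl; congr (_ *: _).
    by apply/eqP; rewrite eq_complex /=; apply/andP; split; apply/eqP; ring.
  rewrite scalerDr !uD iE aE !uD uN !uZ.
  by apply/andP; split; apply/eqP; ring.
have uT z : u (T z) = 0.
  have h v : u (T v) <= 0.
    by apply: le_trans (up _) _; have := range_dist_le (T v) v; rewrite subrr rnorm0.
  apply/le_anti; rewrite h /=; have := h (- z).
  by rewrite linearN uN oppr_le0.
have ux x : `|u x| <= rnorm x.
  have h v : u v <= rnorm v.
    by apply: le_trans (up v) _; have := range_dist_le v 0; rewrite linear0 subr0.
  by rewrite ler_norml h andbT lerNl -uN -rnormN.
(* The real and the imaginary part are each at most [rnorm x] in modulus; the crude constant 2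
   suffices for continuity. *)
have fb x : rnorm (f x) <= 2 * rnorm x.
  have -> : rnorm (f x) = Num.sqrt (u x ^+ 2 + (- u ('i *: x)) ^+ 2) by [].
  have n0 := rnorm_ge0 x.
  have ni : rnorm ('i *: x) = rnorm x.
    by rewrite rnormZ normc_def /= expr0n expr1n add0r sqrtr1 mul1r.
  have sq (a : R) : `|a| <= rnorm x -> a ^+ 2 <= rnorm x ^+ 2.
    by move=> ax; rewrite -real_normK ?num_real// ler_pXn2r ?nnegrE.
  rewrite -[leRHS](@ger0_norm _ _ (mulr_ge0 (ler0n _ 2) n0)) -sqrtr_sqr.
  rewrite ler_sqrt ?sqr_ge0// sqrrN exprMn.
  have := sq _ (ux x); have := sq (u ('i *: x)); rewrite -{1}ni ux => /(_ isT).
  by nra.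
exists (mk_bop fl fb); split=> [|z] /=.
  by rewrite /f eq_complex /= uy negb_and gt_eqF.
rewrite /f -linearZ !uT oppr0; exact/eqP.
Qed.

End Separation.

(** * Invertibility from lower bounds on an operator and its adjoint *)

Section Coercivity.
Variable R : realType.
Implicit Types V W : normedModType R[i].

(* For bounded operators on a Banach space, [coercive c T] with [0 < c] means that [T] is
   invertible with an inverse of norm at most [c^-1]. *)
Definition coercive V W (c : R) (T : bop V W) : Prop :=
  (forall x, c * rnorm x <= rnorm (T x)) /\
  (forall phi : dual W, c * rnorm phi <= rnorm (badjoint T phi)).

(** The adjoint of [T - T'] has norm at most [rnorm (T - T')], so neither lower bound drops by more
    than that. *)
Lemma coercive_perturb V W c (T T' : bop V W) :
  coercive c T -> coercive (c - rnorm (T - T')) T'.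
Proof.
move=> [Tx Tphi]; split=> [x|phi]; rewrite mulrBl lerBlDr.
  apply: le_trans (Tx x) _; rewrite -{1}(subrK (T' x) (T x)) addrC.
  apply: le_trans (ler_rnormD _ _) _; rewrite lerD2l -bopB.
  exact: rnorm_bop_le.
apply: le_trans (Tphi phi) _.
have -> : badjoint T phi = badjoint T' phi + badjoint (T - T') phi.
  apply: bop_ext => x; rewrite -[LHS]/(phi (T x)).
  have -> : T x = T' x + (T - T') x by rewrite bopB addrC subrK.
  exact: (linearD phi).
by apply: le_trans (ler_rnormD _ _) _; rewrite lerD2l; exact: badjoint_bound.
Qed.

(** The hypothesis on [c] is a product, which also covers the inverse of norm 0 on the zero
    space. *)
Lemma inverse_coercive V W c (T : bop V W) (S : bop W V) :
  is_inverse T S -> 0 <= c -> c * opnorm S <= 1 -> coercive c T.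
Proof.
move=> [ST TS] c0 cS.
have key a b : 0 <= b -> a <= opnorm S * b -> c * a <= b.
  move=> b0 aSb; apply: le_trans (ler_wpM2l c0 aSb) _.
  by rewrite mulrA ler_piMl.
split=> [x|phi]; apply: key; rewrite ?rnorm_ge0//.
  have {1}<- : bcomp S T x = x by rewrite ST.
  exact: (rnorm_bop_le S).
have {1}-> : phi = badjoint S (badjoint T phi).
  apply: bop_ext => y; rewrite -[RHS]/(phi (bcomp T S y)).
  by rewrite TS.
exact: badjoint_bound.
Qed.

(** The bound on the adjoint makes the range dense; the bound on [T] gives injectivity and, by
    completeness, a closed range. *)
Lemma coercive_invertible V W c (T : bop V W) : rcomplete V -> 0 < c ->
  coercive c T -> exists2 S, is_inverse T S & c * opnorm S <= 1.
Proof.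
move=> cV c0 [Tx Tphi].
have dense y : range_dist T y = 0.
  apply/le_anti; rewrite range_dist_ge0 andbT leNgt; apply/negP => y0.
  have [phi [phiy phiT]] := range_separation y0.
  have phi0 : phi = 0.
    apply: rnorm_eq0; apply/le_anti; rewrite rnorm_ge0 andbT -(ler_pM2l c0) mulr0.
    apply: le_trans (Tphi phi) _; rewrite (_ : badjoint T phi = 0) ?rnorm0//.
    by apply: bop_ext => z; exact: phiT.
  by move: phiy; rewrite phi0 eqxx.
have near y (e : R) : 0 < e -> exists z, rnorm (y - T z) <= e.
  move=> e0; have [] := @inf_adherent _ [set rnorm (y - T z) | z in [set: V]] e e0.
    split; first by exists (rnorm (y - T 0)), 0.
    by exists 0 => _ [z _ <-]; exact: rnorm_ge0.
  move=> _ [z _ <-]; rewrite -/(range_dist T y) dense add0r => /ltW yz.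
  by exists z.
have surj y : exists x, T x = y.
  have /choice[z zP] (n : nat) : exists z, rnorm (y - T z) <= n.+1%:R^-1.
    by apply: near; rewrite invr_gt0.
  have small (e : R) : 0 < e -> exists N, forall n, (N <= n)%N -> n.+1%:R^-1 <= e.
    move=> e0; exists (Num.truncn e^-1) => n Nn.
    rewrite invf_ple ?posrE//; apply: ltW; apply: lt_le_trans (truncnS_gt _) _.
    by rewrite ler_nat.
  (* The values [T (z n)] converge to [y], so the lower bound makes [z] a Cauchy sequence. *)
  have [|x xP] := cV z.
    move=> e e0; have [N NP] := small (c * e / 2) (divr_gt0 (mulr_gt0 c0 e0) (ltr0Sn _ 1)).
    exists N => m n Nm Nn; rewrite -(ler_pM2l c0); apply: le_trans (Tx _) _.
    rewrite linearB -(subrKA y) -[T (z m) - y]opprB [X in rnorm X]addrC.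
    apply: le_trans (ler_rnormD _ _) _; rewrite rnormN [leRHS]splitr.
    by apply: lerD; [apply: le_trans (zP n) (NP n Nn)|apply: le_trans (zP m) (NP m Nm)].
  exists x; apply/eqP; rewrite -subr_eq0; apply/eqP/rnorm_small0 => e e0.
  have e20 : 0 < e / 2 by rewrite divr_gt0.
  have d0 : 0 < e / 2 / (opnorm T + 1) by rewrite divr_gt0// ltr_wpDl ?opnorm_ge0.
  have [N NP] := small _ e20; have [M MP] := xP _ d0.
  pose n := maxn N M.
  rewrite -rnormN opprB -(subrKA (T (z n))) -linearB.
  apply: le_trans (ler_rnormD _ _) _; rewrite [leRHS]splitr; apply: lerD.
    exact: le_trans (zP n) (NP n (leq_maxl _ _)).
  apply: le_trans (rnorm_bop_le _ _) _.
  have := MP n (leq_maxr _ _); rewrite ler_pdivlMr ?ltr_wpDl ?opnorm_ge0//.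
  by apply: le_trans; rewrite mulrC ler_wpM2l ?rnorm_ge0// lerDl.
have /choice[S SP] := surj.
have inj x x' : T x = T x' -> x = x'.
  move=> xx'; apply/eqP; rewrite -subr_eq0; apply/eqP/rnorm_eq0/le_anti.
  rewrite rnorm_ge0 andbT -(ler_pM2l c0) mulr0; apply: le_trans (Tx _) _.
  have -> : T (x - x') = T x - T x' by rewrite linearB.
  by rewrite xx' subrr rnorm0.
have Sl : linear S.
  move=> a x y; apply: inj.
  have -> : T (a *: S x + S y) = a *: T (S x) + T (S y) by rewrite linearP.
  by rewrite !SP.
have Sb y : rnorm (S y) <= c^-1 * rnorm y.
  by rewrite ler_pdivlMl//; apply: le_trans (Tx _) _; rewrite SP.
exists (mk_bop Sl Sb).
  by split; apply: bop_ext => x; [apply: inj; exact: SP|exact: SP].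
rewrite mulrC -ler_pdivlMr// mul1r; apply: opnorm_le => //.
by rewrite invr_ge0 ltW.
Qed.

Lemma inverse_unique V W (T : bop V W) S S' : is_inverse T S -> is_inverse T S' -> S = S'.
Proof.
move=> [ST TS] [S'T TS']; apply: bop_ext => y.
have : bcomp T S' y = y by rewrite TS'.
move=> /= {1}<-; rewrite -[LHS]/(bcomp S T (S' y)).
by rewrite ST.
Qed.

Lemma inv_normE V W (T : bop V W) S : is_inverse T S -> inv_norm T = (opnorm S)%:E.
Proof.
move=> TS; rewrite /inv_norm; case: pselect => [TI|[]]; last by exists S.
by congr (_%:E); congr opnorm; exact: inverse_unique (projT2 (cid TI)) TS.
Qed.

(** One description of the complement for [eps = 0] and [eps > 0] alike; the strict inequality
    [eps < c] leaves room for perturbations. *)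
Lemma pseudospectrumPn V (B : bop V V) (eps : R) lambda : rcomplete V -> 0 <= eps ->
  ~ pseudospectrum eps B lambda <->
  exists2 c : R, eps < c & coercive c (B - lambda *: bid V).
Proof.
move=> cV eps0; rewrite /pseudospectrum; set T := B - _; split; last first.
  move=> [c epsc Tc]; have c0 : 0 < c := le_lt_trans eps0 epsc.
  have [S TS cS] := coercive_invertible cV c0 Tc.
  case: eqP => _ /=; first by move=> /(_ (ex_intro _ S TS)).
  rewrite -/T (inv_normE TS); apply/negP; rewrite -ltNge inver.
  case: eqP => [_|/eqP S0]; first exact: ltry.
  rewrite lte_fin (lt_le_trans epsc)// -[leRHS]mul1r ler_pdivlMr//.
  by rewrite lt_def S0 opnorm_ge0.
case: eqP => [-> /contrapT [S TS]|e0].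
  exists (opnorm S + 1)^-1; first by rewrite invr_gt0 ltr_wpDl ?opnorm_ge0.
  apply: inverse_coercive TS _ _; first by rewrite invr_ge0 addr_ge0 ?opnorm_ge0.
  by rewrite ler_pdivrMl ?mulr1 ?lerDl// ltr_wpDl ?opnorm_ge0.
rewrite /= -/T; have [[S TS]|TI] := pselect (invertible T); last first.
  rewrite /inv_norm; case: pselect => [//|_]; rewrite invey => /negP.
  by rewrite lee_fin eps0.
rewrite (inv_normE TS) => /negP; rewrite -ltNge inver.
(* If [S] has norm 0, its extended inverse is [+oo] and any constant beyond [eps] works. *)
case: eqP => [S0 _|/eqP S0].
  exists (eps + 1); first by rewrite ltrDl.
  by apply: inverse_coercive TS _ _; rewrite ?S0 ?mulr0// addr_ge0.
rewrite lte_fin => Seps; exists (opnorm S)^-1 => //.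
by apply: inverse_coercive TS _ _; rewrite ?invr_ge0 ?opnorm_ge0// mulVf.
Qed.

End Coercivity.

(** * The sets Gamma and tridiagonal forms *)

Section Gamma.
Variables (R : realType) (V : normedModType R[i]).
Implicit Types (T : bop (l2 int V) (l2 int V)) (n : nat) (kappa c : R) (lambda : R[i]).

Lemma entry_shift T lambda (i j : int) : i != j ->
  entry (T - lambda *: bid _) i j = entry T i j.
Proof.
move=> ij; apply: bop_ext => v.
rewrite -[LHS]/((T - lambda *: bid _) (l2_single j v) i) bopB l2B bopZ l2Z.
have -> : bid _ (l2_single j v) i = 0 by rewrite /= /l2_single_fun (negPf ij).
by rewrite scaler0 subr0.
Qed.

Lemma has_bandwidth_shift T lambda : has_bandwidth 1 T ->
  has_bandwidth 1 (T - lambda *: bid _).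
Proof.
move=> T1 i j ij; rewrite entry_shift ?T1//.
by apply: contraTneq ij => ->; rewrite subrr normr0.
Qed.

Lemma eps_pp_shift n T lambda : eps_pp n (T - lambda *: bid _) = eps_pp n T.
Proof.
rewrite /eps_pp /offdiag_norm; congr (_ * _ * _); congr (sup _ + sup _);
  by apply: eq_imagel => i _; rewrite entry_shift//; lia.
Qed.

Lemma eps_ppE (U : normedModType R[i]) n (T : bop (l2 int U) (l2 int U)) :
  eps_pp n T = gap R n * offdiag_norm T.
Proof. by rewrite /eps_pp mulrAC. Qed.

Lemma eps_pp_ge0 n T : 0 <= eps_pp n T.
Proof. by rewrite eps_ppE mulr_ge0 ?gap_ge0 ?offdiag_norm_ge0. Qed.

Lemma eps_pp_adjoint_le n T : has_bandwidth 1 T -> eps_pp n (tridiag_adjoint T) <= eps_pp n T.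
Proof.
move=> T1; rewrite !eps_ppE ler_wpM2l ?gap_ge0//.
exact: offdiag_adjoint_le.
Qed.

Lemma lower_norm_on_le (U W : normedModType R[i]) (B : bop U W) (S : set U) (c : R) :
  (forall a x, S x -> S (a *: x)) -> (c%:E <= lower_norm_on B S)%E ->
  forall x, S x -> c * rnorm x <= rnorm (B x).
Proof.
move=> SZ cB x Sx; have [x0|x0] := eqVneq (rnorm x) 0.
  by rewrite x0 mulr0 rnorm_ge0.
have xp : 0 < rnorm x by rewrite lt_def x0 rnorm_ge0.
rewrite -ler_pdivlMr//.
pose a : R[i] := ((rnorm x)^-1%:C)%C.
have na : complex.Re `|a| = (rnorm x)^-1.
  by rewrite -[LHS]/(@rnorm R R[i]^o a) rnormC ger0_norm// invr_ge0 ltW.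
rewrite mulrC -na -rnormZ -linearZ -lee_fin; apply: le_trans cB _.
apply: ereal_inf_lbound; exists (a *: x) => //; split; first exact: SZ.
by rewrite rnormZ na mulVf.
Qed.

Lemma windowZ (U : normedModType R[i]) n k a (x : l2 int U) :
  window n k x -> window n k (a *: x).
Proof. by move=> wx i ik; rewrite l2Z wx// scaler0. Qed.

(** Outside [Gamma] the lower bounds hold on all windows; localization extends them to the whole
    space for the operator and, through [dual_coords], for its adjoint. *)
Lemma not_Gamma_coercive n kappa T lambda : (0 < n)%N -> has_bandwidth 1 T -> 0 <= kappa ->
  ~ Gamma n kappa T lambda ->
  exists2 c : R, kappa < c & coercive (c - eps_pp n T) (T - lambda *: bid _).
Proof.
move=> n0 T1 kappa0; rewrite /Gamma /=; set D := T - _ => /negP.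
have D1 : has_bandwidth 1 D := has_bandwidth_shift lambda T1.
rewrite -ltNge => mukappa.
(* The infimum [mu] is [+oo] if there are no unit vectors; then any [c] beyond [kappa] serves. *)
have [c kc cmu] : exists2 c : R, kappa < c & (c%:E <= mu n D)%E.
  case: (mu n D) mukappa => [r||] //; first by rewrite lte_fin => kr; exists r.
  by exists (kappa + 1); rewrite ?ltrDl// leey.
have c0 : 0 <= c := ltW (le_lt_trans kappa0 kc).
exists c => //.
have cmin k : (c%:E <= Order.min (lower_norm_on D (@window R V n k))
    (lower_norm_on (tridiag_adjoint D) (@window R (dual V) n k)))%E.
  by apply: le_trans cmu _; apply: ereal_inf_lbound; exists k.
have cwin k x : window n k x -> c * rnorm x <= rnorm (D x).
  apply: lower_norm_on_le x => [a x|]; first exact: windowZ.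
  by apply: le_trans (cmin k) _; rewrite ge_min lexx.
have cwin' k f : window n k f -> c * rnorm f <= rnorm (tridiag_adjoint D f).
  apply: lower_norm_on_le f => [a x|]; first exact: windowZ.
  by apply: le_trans (cmin k) _; rewrite ge_min lexx orbT.
split=> [x|phi]; rewrite mulrBl lerBlDr.
  by rewrite -(eps_pp_shift n T lambda); exact: window_lower_bound.
rewrite -(rnorm_dual_coords phi) -(rnorm_dual_coords (badjoint D phi)).
rewrite -tridiag_adjoint_coords//.
apply: le_trans (window_lower_bound n0 (has_bandwidth_tridiag_adjoint D1) c0 cwin' _) _.
rewrite lerD2l ler_wpM2r ?rnorm_ge0// -(eps_pp_shift n T lambda).
exact: eps_pp_adjoint_le.
Qed.

(** Restricting global bounds to windows loses nothing, so [eps_pp] does not enter here. *)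
Lemma coercive_not_Gamma n kappa T lambda c : has_bandwidth 1 T -> kappa < c ->
  coercive c (T - lambda *: bid _) -> ~ Gamma n kappa T lambda.
Proof.
move=> T1 kc; rewrite /Gamma /=; set D := T - _ => -[Dx Dphi].
have D1 : has_bandwidth 1 D := has_bandwidth_shift lambda T1.
apply/negP; rewrite -ltNge; apply: lt_le_trans (_ : c%:E <= _)%E; first by rewrite lte_fin.
apply: le_ereal_inf_tmp => _ [k _ <-]; rewrite le_min; apply/andP; split.
  apply: le_ereal_inf_tmp => _ [x [_ x1] <-]; rewrite lee_fin.
  by apply: le_trans (Dx x); rewrite x1 mulr1.
apply: le_ereal_inf_tmp => _ [f [wf f1] <-]; rewrite lee_fin.
have [phi phif] := window_dual_coords wf.
rewrite -phif tridiag_adjoint_coords// rnorm_dual_coords.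
by apply: le_trans (Dphi phi); rewrite -(rnorm_dual_coords phi) phif f1 mulr1.
Qed.

End Gamma.

(** * Passage to tridiagonal form *)

Section TridiagonalForm.
Variables (R : realType) (V : normedModType R[i]).

(** Mutually inverse contractions are isometries, and so are their adjoints. *)
Lemma coercive_conj (U W : normedModType R[i]) (Q : bop U W) (P : bop W U) c (T : bop U U) :
  is_inverse Q P -> opnorm Q <= 1 -> opnorm P <= 1 -> 0 <= c ->
  coercive c T -> coercive c (bcomp Q (bcomp T P)).
Proof.
move=> [PQ QP] Q1 P1 c0 [Tx Tphi].
have contr (Z Z' : normedModType R[i]) (S : bop Z Z') (x : Z) :
    opnorm S <= 1 -> rnorm (S x) <= rnorm x.
  by move=> S1; apply: le_trans (rnorm_bop_le S x) _; rewrite ler_piMl ?rnorm_ge0.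
have contr' (Z Z' : normedModType R[i]) (S : bop Z Z') (phi : dual Z') :
    opnorm S <= 1 -> rnorm (badjoint S phi) <= rnorm phi.
  by move=> S1; apply: contr; apply: le_trans (opnorm_badjoint_le S) S1.
split=> [x|phi].
  rewrite -[bcomp Q _ x]/(Q (T (P x))).
  have := contr _ _ P (Q (T (P x))) P1.
  rewrite -[P (Q _)]/(bcomp P Q _) PQ => /(le_trans _); apply.
  apply: le_trans (Tx _); rewrite ler_wpM2l//.
  have {1}<- : bcomp Q P x = x by rewrite QP.
  exact: (contr _ _ Q (P x) Q1).
have -> : badjoint (bcomp Q (bcomp T P)) phi = badjoint P (badjoint T (badjoint Q phi)).
  exact: bop_ext.
set psi := badjoint Q phi.
have E : badjoint Q (badjoint P (badjoint T psi)) = badjoint T psi.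
  by apply: bop_ext => x; rewrite -[LHS]/(badjoint T psi (bcomp P Q x)) PQ.
have := contr' _ _ Q (badjoint P (badjoint T psi)) Q1; rewrite E.
move=> /(le_trans _); apply; apply: le_trans (Tphi _); rewrite ler_wpM2l//.
have {1}-> : phi = badjoint P psi.
  by apply: bop_ext => x; rewrite -[RHS]/(phi (bcomp Q P x)) QP.
exact: (contr' _ _ P psi P1).
Qed.

Lemma bcomp_conjK (U W : normedModType R[i]) (Q : bop U W) (P : bop W U) (T : bop U U) :
  is_inverse Q P -> bcomp P (bcomp (bcomp Q (bcomp T P)) Q) = T.
Proof.
move=> [PQ _]; apply: bop_ext => x.
by rewrite -[LHS]/(bcomp P Q (T (bcomp P Q x))) PQ.
Qed.

Lemma is_inverse_sym (U W : normedModType R[i]) (Q : bop U W) (P : bop W U) :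
  is_inverse Q P -> is_inverse P Q.
Proof. by case. Qed.

Lemma banded_vanish (B : bop (l2 int V) (l2 int V)) b (y : l2 int V) (i : int) :
  has_bandwidth b B -> (forall m : int, `|i - m| <= b%:Z -> y m = 0) -> B y i = 0.
Proof.
move=> Bb y0; apply: (@bop_single_eq0 _ _ _ _ (bcomp (l2_coord V i) B)) => m.
rewrite -[LHS]/(entry B i m (y m)).
have [im|im] := leP `|i - m| b%:Z; last by rewrite Bb.
by rewrite y0// linear0.
Qed.

(** Indices in blocks whose numbers differ by at least 2 are at least [b + 1] apart, because a whole
    block lies between them. *)
Lemma has_bandwidth_tridiagonal_form b B : (0 < b)%N -> has_bandwidth b B ->
  has_bandwidth 1 (@tridiagonal_form R V b B).
Proof.
move=> b0 Bb i j ij; apply: bop_ext => xi; apply: l2_ext => p.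
rewrite -[LHS]/(B (unblock V b (l2_single j xi)) (i * b%:Z + 1 + (p : nat)%:Z)).
apply: banded_vanish Bb _ => m im.
rewrite -[LHS]/(unblock_raw (l2_single j xi) m) /unblock_raw.
case: insubP => // q _ _; rewrite -[_ ((m - 1) %/ b)%Z]/(l2_single_fun j xi ((m - 1) %/ b)%Z).
rewrite /l2_single_fun ifF//; apply/negP => /eqP mj.
have bZ : b%:Z != 0 by rewrite eqz_nat -lt0n.
have m1 := divz_eq (m - 1) b; rewrite mj in m1.
have r0 := modz_ge0 (m - 1) bZ.
have rb : ((m - 1) %% b)%Z < b%:Z by rewrite ltz_pmod.
have pb := ltn_ord p.
move: ij im; rewrite ltr_normr ler_norml => /orP[] ij /andP[im1 im2]; nia.
Qed.

Lemma opnorm_block_le b : opnorm (block V b) <= 1.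
Proof. by apply: opnorm_le => // x; exact: block_bound. Qed.

Lemma opnorm_unblock_le b : opnorm (unblock V b) <= 1.
Proof. by apply: opnorm_le => // x; exact: unblock_bound. Qed.

Lemma bcomp_shift (U W : normedModType R[i]) (Q : bop U W) (P : bop W U) (T : bop U U) lambda :
  bcomp Q (bcomp (T - lambda *: bid U) P) = bcomp Q (bcomp T P) - lambda *: bcomp Q P.
Proof. by apply: bop_ext => x /=; rewrite linearB linearZ. Qed.

Lemma tridiagonal_form_shift b B lambda : (0 < b)%N ->
  tridiagonal_form b B - lambda *: bid _ =
  @tridiagonal_form R V b (B - lambda *: bid _).
Proof.
move=> b0; have [_ QP] := block_unblock V b0.
by rewrite /tridiagonal_form bcomp_shift QP.
Qed.

Lemma coercive_tridiagonal_form b B lambda c : (0 < b)%N -> 0 <= c ->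
  coercive c (@tridiagonal_form R V b B - lambda *: bid _) <->
  coercive c (B - lambda *: bid _).
Proof.
move=> b0 c0; rewrite tridiagonal_form_shift//.
have PQ := block_unblock V b0.
have n1 := opnorm_block_le b; have n2 := opnorm_unblock_le b.
split=> [h|]; last exact: coercive_conj.
rewrite -(bcomp_conjK (B - lambda *: bid _) PQ).
exact: coercive_conj (is_inverse_sym PQ) n2 n1 c0 h.
Qed.

Lemma opnorm_tridiagonal_form_le b B : opnorm (@tridiagonal_form R V b B) <= opnorm B.
Proof.
apply: opnorm_le => [|x]; first exact: opnorm_ge0.
apply: le_trans (rnorm_bop_le (block V b) _) _.
apply: le_trans (ler_wpM2r (rnorm_ge0 _) (opnorm_block_le b)) _; rewrite mul1r.
apply: le_trans (rnorm_bop_le B _) _; rewrite ler_wpM2l ?opnorm_ge0//.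
by apply: le_trans (unblock_bound x) _; rewrite mul1r.
Qed.

(** Together with [opnorm_tridiagonal_form_le], this bound is uniform in the block length. *)
Lemma eps_pp_le n (T : bop (l2 int V) (l2 int V)) : eps_pp n T <= 2 * gap R n * opnorm T.
Proof.
by rewrite eps_ppE; have := offdiag_norm_le T; have := gap_ge0 R n; nra.
Qed.

End TridiagonalForm.

(** * Hausdorff convergence *)

Section Limit.
Variable R : realType.

Lemma normC_le (z : R[i]) : complex.Re `|z| <= `|complex.Re z| + `|complex.Im z|.
Proof.
case: z => a b; rewrite normc_def /=.
have s0 : 0 <= `|a| + `|b| by rewrite addr_ge0.
rewrite -[leRHS](ger0_norm s0) -sqrtr_sqr ler_sqrt ?sqr_ge0//.
rewrite -[a ^+ 2]real_normK ?num_real// -[b ^+ 2]real_normK ?num_real//.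
by rewrite sqrrD lerD2r lerDl mulrn_wge0// mulr_ge0.
Qed.

(** Bolzano-Weierstrass, from the compactness of a square in the real plane. *)
Lemma bounded_cluster (t : nat -> R[i]) (M : R) : (forall m, complex.Re `|t m| <= M) ->
  exists t0, forall (r : R) N, 0 < r -> exists2 m, (N <= m)%N & complex.Re `|t m - t0| <= r.
Proof.
move=> tM; pose K := (`[- M, M] `*` `[- M, M])%classic : set (R * R).
have cK : compact K by apply: compact_setX; exact: segment_compact.
pose u m : R * R := (complex.Re (t m), complex.Im (t m)).
have uK : (u @ \oo) K.
  exists 0%N => // m _; rewrite /K /u /= !in_itv /= -!ler_norml.
  have sq (c d : R) : `|c| <= Num.sqrt (c ^+ 2 + d ^+ 2).
    by rewrite -sqrtr_sqr ler_sqrt ?addr_ge0 ?sqr_ge0// lerDl sqr_ge0.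
  have : Num.sqrt (complex.Re (t m) ^+ 2 + complex.Im (t m) ^+ 2) <= M.
    by have := tM m; case: (t m) => a b; rewrite normc_def.
  by move=> h; split; apply: le_trans h; rewrite ?sq// addrC sq.
have [[a b] [_ pcl]] := cK _ _ uK.
exists (a +i* b)%C => r N r0.
have r20 : 0 < r / 2 by rewrite divr_gt0.
have uN : (u @ \oo) [set u m | m in [set m | (N <= m)%N]].
  by exists N => // m /= Nm; exists m.
have [_ [[m Nm <-] [/= am bm]]] := pcl _ _ uN (nbhsx_ballx (a, b) _ r20).
exists m => //; apply: le_trans (normC_le _) _.
move: am bm; rewrite /u -!ball_normE /ball_ /=.
case: (t m) => x y /= am bm; rewrite [leRHS]splitr; apply: lerD; rewrite distrC ltW//.
Qed.

End Limit.

Section Pseudospectra.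
Variables (R : realType) (V : normedModType R[i]).
Hypothesis cV : rcomplete V.
Implicit Types (A B : bop V V) (eps : R) (lambda : R[i]).

Lemma pseudospectrum_subset A eps eps' : 0 <= eps -> eps <= eps' ->
  pseudospectrum eps A `<=` pseudospectrum eps' A.
Proof.
move=> e0 ee' l; apply: contraPP => /(pseudospectrumPn _ _ cV (le_trans e0 ee'))[c ec cA].
by apply/(pseudospectrumPn _ _ cV e0); exists c => //; exact: le_lt_trans ec.
Qed.

Lemma coercive_shift_op A B lambda c : coercive c (A - lambda *: bid V) ->
  coercive (c - rnorm (A - B)) (B - lambda *: bid V).
Proof.
move=> cA; have := coercive_perturb (B - lambda *: bid V) cA.
by rewrite opprB addrA subrK.
Qed.

Lemma coercive_shift_point A lambda lambda' c : coercive c (A - lambda *: bid V) ->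
  coercive (c - complex.Re `|lambda' - lambda|) (A - lambda' *: bid V).
Proof.
move=> cA; have := coercive_perturb (A - lambda' *: bid V) cA.
have -> : A - lambda *: bid V - (A - lambda' *: bid V) = (lambda' - lambda) *: bid V.
  by rewrite opprB addrC addrA subrK scalerBl.
have : rnorm ((lambda' - lambda) *: bid V) <= complex.Re `|lambda' - lambda|.
  rewrite rnormZ ler_piMr ?Re_norm_ge0//; apply: opnorm_le => // x; exact: bid_bound.
move=> le [h1 h2]; split=> x; [apply: le_trans (h1 x)|apply: le_trans (h2 x)];
  by rewrite ler_wpM2r ?rnorm_ge0// lerD2l lerN2.
Qed.

(** The operator [- lambda *: bid V] satisfies both bounds with the modulus of [lambda] as constant,
    and adding [A] costs at most [opnorm A]. *)
Lemma pseudospectrum_bounded A eps lambda : 0 <= eps ->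
  pseudospectrum eps A lambda -> complex.Re `|lambda| <= opnorm A + eps.
Proof.
move=> e0; apply: contraPT; rewrite -ltNge => Al.
apply/(pseudospectrumPn _ _ cV e0); exists (complex.Re `|lambda| - opnorm A); first by lra.
have c0 : coercive (complex.Re `|lambda|) (0 - lambda *: bid V).
  rewrite sub0r -scaleNr -(normrN lambda); split=> [x|phi]; first by rewrite bopZ rnormZ.
  rewrite -rnormZ le_eqVlt; apply/orP; left; apply/eqP; congr rnorm.
  by apply: bop_ext => x; rewrite bopZ -[RHS]/(phi (- lambda *: x)) linearZ.
by have := coercive_shift_op A c0; rewrite sub0r rnormN.
Qed.

(* The inequality in [pseudospectrum] is non-strict, so that [pseudospectrum eps A] is the
   intersection of the pseudospectra of larger levels, and compactness applies. *)
Lemma pseudospectrum_outer_limit A eps (rho : R) : 0 <= eps -> 0 < rho ->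
  exists2 theta : R, 0 < theta & forall lambda, pseudospectrum (eps + theta) A lambda ->
    (dist_to lambda (pseudospectrum eps A) <= rho%:E)%E.
Proof.
move=> e0 rho0; apply: contrapT => H.
(* If no [theta] works, each level [eps + m.+1%:R^-1] has a point [t m] farther than [rho] from the
   limit set. *)
have /choice[t tP] (m : nat) : exists lambda, pseudospectrum (eps + m.+1%:R^-1) A lambda /\
    ~ (dist_to lambda (pseudospectrum eps A) <= rho%:E)%E.
  apply: contrapT => H'; apply: H; exists m.+1%:R^-1; first by rewrite invr_gt0.
  by move=> lambda Al; apply: contrapT => dl; apply: H'; exists lambda.
have tb m : complex.Re `|t m| <= opnorm A + (eps + 1).
  have e1 : 0 <= eps + m.+1%:R^-1 by rewrite addr_ge0// invr_ge0.
  apply: le_trans (pseudospectrum_bounded e1 (tP m).1) _.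
  by rewrite !lerD2l invf_le1// ler1n.
have [t0 t0P] := bounded_cluster tb.
have [St0|] := pselect (pseudospectrum eps A t0).
  have [m _ tm] := t0P rho 0%N rho0; apply: (tP m).2.
  by apply: ge_ereal_inf; exists (complex.Re `|t m - t0|)%:E; [exists t0|].
move=> /(pseudospectrumPn _ _ cV e0)[c ec cA].
(* There is a margin [c - eps] at [t0]: one half absorbs the move to [t m], the other exceeds
   [m.+1%:R^-1]. *)
have d0 : 0 < (c - eps) / 2 by rewrite divr_gt0// subr_gt0.
have [m Nm tm] := t0P _ (Num.truncn ((c - eps) / 2)^-1) d0.
have e1 : 0 <= eps + m.+1%:R^-1 by rewrite addr_ge0// invr_ge0.
have : ~ pseudospectrum (eps + m.+1%:R^-1) A (t m).
  apply/(pseudospectrumPn _ _ cV e1).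
  exists (c - complex.Re `|t m - t0|); last exact: coercive_shift_point.
  have : m.+1%:R^-1 < (c - eps) / 2.
    rewrite invf_plt ?posrE//; apply: lt_le_trans (truncnS_gt _) _.
    by rewrite ler_nat.
  by move=> h; rewrite ltrBrDr -addrA -ltrBrDl [ltRHS]splitr; exact: ltr_leD.
by apply; exact: (tP m).1.
Qed.

(** The first inclusion disposes of one of the two suprema; the second inclusion reduces the other
    to [pseudospectrum_outer_limit]. *)
Lemma hausdorff_dist_pseudospectrum_cvg A eps (G : nat -> set R[i]) (eta : nat -> R) :
  0 <= eps -> eta n @[n --> \oo] --> (0 : R) -> (forall n, (0 < n)%N -> 0 <= eta n) ->
  (forall n, (0 < n)%N ->
    pseudospectrum eps A `<=` G n /\ G n `<=` pseudospectrum (eps + eta n) A) ->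
  hausdorff_dist (G n) (pseudospectrum eps A) @[n --> \oo] --> 0%E.
Proof.
move=> e0 eta0 eta_ge0 GP.
have near0 rho : 0 < rho -> \forall n \near \oo,
    (0 <= hausdorff_dist (G n) (pseudospectrum eps A) <= rho%:E)%E.
  move=> rho0; have [theta th0 thP] := pseudospectrum_outer_limit A e0 rho0.
  have etath : \forall n \near \oo, eta n <= theta.
    have /cvgrPdist_le/(_ _ th0) := eta0.
    apply: filterS => n; rewrite sub0r normrN; exact: le_trans (ler_norm _).
  have npos : \forall n \near \oo, (0 < n)%N by exists 1%N.
  near=> n; have n0 : (0 < n)%N by near: n.
  have [SG GS] := GP n n0; apply/andP; split; first by rewrite le_max lexx.
  rewrite /hausdorff_dist !ge_max lee_fin (ltW rho0) /=; apply/andP; split.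
    apply: ge_ereal_sup => _ [s /GS Gs <-]; apply: thP.
    apply: pseudospectrum_subset Gs; first by rewrite addr_ge0// eta_ge0.
    by rewrite lerD2l; near: n.
  apply: ge_ereal_sup => _ [s Ss <-]; apply: ge_ereal_inf.
  exists 0%:E; last by rewrite lee_fin ltW.
  by exists s; [exact: SG|rewrite subrr normr0].
apply/fine_cvgP; split.
  apply: filterS (near0 1 ltr01) => n /andP[h0 h1].
  by rewrite ge0_fin_numE// (le_lt_trans h1)// ltry.
apply/cvgrPdist_le => r r0; apply: filterS (near0 r r0) => n /andP[h0 h1] /=.
have hf : hausdorff_dist (G n) (pseudospectrum eps A) \is a fin_num.
  by rewrite ge0_fin_numE// (le_lt_trans h1)// ltry.
by rewrite sub0r normrN ger0_norm ?fine_ge0// -lee_fin fineK.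
Unshelve. all: by end_near. Qed.

End Pseudospectra.

Lemma gap_cvg0 (R : realType) : gap R n @[n --> \oo] --> (0 : R).
Proof.
have -> : 0 = 2 * sin (pi / 2 * 0) :> R by rewrite mulr0 sin0 mulr0.
rewrite /gap; apply: cvgMr; apply: continuous_cvg; first exact: continuous_sin.
have -> : (fun n => pi / (2 * n.+1%:R)) = (fun n => pi / 2 * n.+1%:R^-1) :> (nat -> R).
  by apply/funext => n; rewrite invfM mulrA.
apply: cvgMr; exact: cvg_harmonic.
Qed.

(** * The two inclusions and the convergence *)

Section Main.
Variables (R : realType) (X : completeNormedModType R[i]).
Implicit Types (A B : bop (l2 int X) (l2 int X)).

(** By contraposition, lower bounds are carried between [T] and [B] unchanged and between [B] and
    [A] at the cost [delta]. Localization costs [eps_pp] in the first inclusion only; in the second,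
    [eps_pp] stems from the level of [Gamma]. *)
Lemma Gamma_inclusions A B w n eps : (0 < w)%N -> has_bandwidth w B -> (0 < n)%N -> 0 <= eps ->
  let delta := rnorm (A - B) in let T := tridiagonal_form w B in
  pseudospectrum eps A `<=` Gamma n (eps + delta + eps_pp n T) T /\
  Gamma n (eps + delta + eps_pp n T) T `<=` pseudospectrum (eps + 2 * delta + eps_pp n T) A.
Proof.
move=> w0 Bw n0 e0 delta T.
have cE : rcomplete (l2 int X) by apply/l2_rcomplete/complete_rcomplete.
have T1 : has_bandwidth 1 T := has_bandwidth_tridiagonal_form w0 Bw.
have d0 : 0 <= delta := rnorm_ge0 _.
have p0 : 0 <= eps_pp n T := eps_pp_ge0 n T.
split=> l; apply: contraPP.
  move=> /(not_Gamma_coercive n0 T1 _)[|c kc cT]; first by rewrite !addr_ge0.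
  apply/(pseudospectrumPn _ _ cE e0); exists (c - eps_pp n T - rnorm (B - A)).
    by rewrite -rnormN opprB -/delta; lra.
  apply: coercive_shift_op; apply/(coercive_tridiagonal_form _ _ w0) => //; lra.
move=> /(pseudospectrumPn _ _ cE _)[|c kc cA]; first by rewrite addr_ge0// addr_ge0// mulr_ge0.
apply: (@coercive_not_Gamma _ _ _ _ _ _ (c - delta)) => //; first by lra.
apply/(coercive_tridiagonal_form _ _ w0); first by lra.
exact: coercive_shift_op.
Qed.

End Main.
Theorem theorem1p6 (R : realType) (X : completeNormedModType R[i])
    (X_fin_or_hilbert : finite_dimensional X \/ hilbert_norm X)
    (A : bop (l2 int X) (l2 int X)) (A_bd : band_dominated A)
    (Aseq : nat -> bop (l2 int X) (l2 int X)) (w : nat -> nat)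
    (w_gt0 : forall n, (0 < n)%N -> (0 < w n)%N)
    (Aseq_band : forall n, (0 < n)%N -> has_bandwidth (w n) (Aseq n))
    (Aseq_cvg : rnorm (A - Aseq n) @[n --> \oo] --> (0 : R)) :
  let delta n := rnorm (A - Aseq n) in
  let T n := tridiagonal_form (w n) (Aseq n) in
  [/\ forall (eps : R) (n : nat), 0 <= eps -> (0 < n)%N ->
        pseudospectrum eps A
          `<=` Gamma n (eps + delta n + eps_pp n (T n)) (T n) /\
        Gamma n (eps + delta n + eps_pp n (T n)) (T n)
          `<=` pseudospectrum (eps + 2 * delta n + eps_pp n (T n)) A,
      forall eps : R, 0 <= eps ->
        hausdorff_dist (Gamma n (eps + delta n + eps_pp n (T n)) (T n))
                       (pseudospectrum eps A) @[n --> \oo] --> 0%E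
    & hausdorff_dist (Gamma n (delta n + eps_pp n (T n)) (T n))
                     (spectrum A) @[n --> \oo] --> 0%E].

Proof.
move=> delta T.
have incl eps n : 0 <= eps -> (0 < n)%N ->
    pseudospectrum eps A `<=` Gamma n (eps + delta n + eps_pp n (T n)) (T n) /\
    Gamma n (eps + delta n + eps_pp n (T n)) (T n)
      `<=` pseudospectrum (eps + 2 * delta n + eps_pp n (T n)) A.
  by move=> e0 n0; apply: Gamma_inclusions => //; [exact: w_gt0|exact: Aseq_band].
have cE : rcomplete (l2 int X) by apply/l2_rcomplete/complete_rcomplete.
pose eta n := 2 * delta n + eps_pp n (T n).
have delta0 n : 0 <= delta n := rnorm_ge0 _.
have epp0 n : 0 <= eps_pp n (T n) := eps_pp_ge0 n (T n).
have eppc : eps_pp n (T n) @[n --> \oo] --> (0 : R).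
  (* The norm of [T n] is at most [rnorm A + delta n], hence bounded whatever the band-widths, and
     [gap] tends to 0. *)
  apply: (@squeeze_cvgr _ _ _ _ (fun=> 0) (fun n => 2 * gap R n * (rnorm A + delta n))).
  - apply: nearW => n; rewrite epp0 /=; apply: le_trans (eps_pp_le _ _) _.
    apply: (ler_wpM2l (mulr_ge0 (ler0n _ 2) (gap_ge0 R n))).
    apply: le_trans (opnorm_tridiagonal_form_le (w n) (Aseq n)) _.
    rewrite -rnorm_bopE -{1}(subrK A (Aseq n)) addrC; apply: le_trans (ler_rnormD _ _) _.
    by rewrite lerD2l -rnormN opprB.
  - exact: cvg_cst.
  - have : 2 * gap R n * (rnorm A + delta n) @[n --> \oo] --> 2 * 0 * (rnorm A + 0).
      by apply: cvgM; [apply: cvgM; [exact: cvg_cst|exact: gap_cvg0]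
                      |apply: cvgD => //; exact: cvg_cst].
    by rewrite mulr0 mul0r.
have etac : eta n @[n --> \oo] --> (0 : R).
  have : eta n @[n --> \oo] --> 2 * 0 + (0 : R).
    by apply: cvgD => //; apply: cvgM => //; exact: cvg_cst.
  by rewrite mulr0 addr0.
have hd eps : 0 <= eps ->
    hausdorff_dist (Gamma n (eps + delta n + eps_pp n (T n)) (T n))
                   (pseudospectrum eps A) @[n --> \oo] --> 0%E.
  move=> e0; apply: (hausdorff_dist_pseudospectrum_cvg cE e0 etac) => n n0.
    by rewrite addr_ge0// mulr_ge0.
  by rewrite /eta addrA; exact: incl.
split=> //; have := hd 0 (lexx 0).
(* At level 0 the pseudospectrum is the spectrum by definition. *)
rewrite [pseudospectrum _ _]/pseudospectrum eqxx.
by under eq_fun do rewrite add0r.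
Qed.
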